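(* Let $d\ge2$ be a fixed integer. For every $j=0,\dots,d-2$, every fixed integer $k\ge1$, every constant $\gamma>0$, and every integer sequence $t=t(n)<\log^\gamma n$ with $t\to\infty$, $$\mathbf E\big([D_j(N-t)]_k\big)\sim f_j(d,t,n)^k \qquad (n\to\infty),$$ where $f_j(d,t,n)=\dfrac{2[d-1]_{d-1-j}\,t}{\log^{d-1-j}n}$.
   Context: The $d$-process $\mathcal P(d,n)$ starts with the empty graph on $n$ vertices and at each step adds one edge chosen uniformly at random from all pairs of distinct vertices that are not yet edges and both of whose vertices currently have degree less than $d$; it stops when no such pair exists. $G_s$ denotes the graph when it has $s$ edges, and $D_i(s)$ is the number of vertices of degree $i$ in $G_s$. $N=\lfloor dn/2\rfloor$. The process can only stop when the vertices of degree less than $d$ form a clique (so there are at most $d$ of them); hence $G_{N-t}$ is always defined once $t>d^2$. $[x]_k=x(x-1)\cdots(x-k+1)$ is the falling factorial. Logarithms are natural; $a_n\sim b_n$ means $a_n/b_n\to 1$. *)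

(* Defs.v *)
From mathcomp Require Import all_boot all_order all_algebra.
From mathcomp Require Import all_classical all_reals all_analysis.
Set Implicit Arguments.
Unset Strict Implicit.
Unset Printing Implicit Defensive.
Import Order.TTheory GRing.Theory Num.Theory.
Import numFieldNormedType.Exports.
Local Open Scope ring_scope.

(* A graph on the vertex set {0, ..., n-1} is given by its set of edges, each
   edge being a two-element set of vertices.  Edge sets containing other sets
   also inhabit this type; they have probability 0 under [dprocess_law]. *)
Definition graph (n : nat) := {set {set 'I_n}}.

Definition deg (n : nat) (G : graph n) (v : 'I_n) : nat :=
  #|[set e in G | v \in e]|.

Definition num_deg (n : nat) (i : nat) (G : graph n) : nat :=
  #|[set v : 'I_n | deg G v == i]|.

Definition available (d n : nat) (G : graph n) : {set {set 'I_n}} :=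
  [set e : {set 'I_n} |
    [&& #|e| == 2, e \notin G & [forall v in e, (deg G v < d)%N]]].

(* Once no pair is available the process stops; to make the chain total, it is
   then kept at its final graph forever. *)
Definition dprocess_step (R : realType) (d n : nat) (G H : graph n) : R :=
  if available d G == finset.set0 then (H == G)%:R
  else \sum_(e in available d G) (H == e |: G)%SET%:R / #|available d G|%:R.

(* [dprocess_law R d s] is the law of G_s.  As each step before stopping adds
   exactly one edge, the graph after s steps is the graph with s edges as long
   as the process has not stopped; this is always so for s = N - t, t > d^2. *)
Fixpoint dprocess_law (R : realType) (d n s : nat) : graph n -> R :=
  if s is s'.+1 then
    fun H => \sum_(G : graph n) dprocess_law R d s' G * dprocess_step R d G H
  else fun H => (H == finset.set0)%:R.

Definition dprocess_E (R : realType) (d n s : nat) (X : graph n -> R) : R :=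
  \sum_(G : graph n) dprocess_law R d s G * X G.

Definition max_edges (d n : nat) : nat := (d * n)./2.

Definition f_asym (R : realType) (j d t n : nat) : R :=
  2 * ((d - 1) ^_ (d - 1 - j))%:R * t%:R / ln (n%:R : R) ^+ (d - 1 - j).

(* Main.v *)
Require Import Defs.
From mathcomp Require Import all_boot all_order all_algebra.
From mathcomp Require Import all_classical all_reals all_analysis.
From mathcomp Require Import zify ring lra.
Set Implicit Arguments.
Unset Strict Implicit.
Unset Printing Implicit Defensive.
Import Order.TTheory GRing.Theory Num.Theory.
Import numFieldNormedType.Exports.
Local Open Scope ring_scope.

(** Call a vertex unsaturated while its degree is less than d, and let u be the
number of unsaturated vertices.  The deficit m = dn - 2s of a graph with s edges
is the sum of d - deg v over all v, so that m/d <= u <= m.  An unsaturated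
vertex lies in the next edge with probability 2/u + O(1/u^2), because it is
adjacent to fewer than d others ([pick_prob_unsat]).  Let a clock x advance by 2/u
at each step.  Up to errors that sum to O(1/t), the degrees grow like
independent Poisson processes of duration x, frozen at d; so D_i should be
proportional to x^i / i! for i < d.  The factor of proportionality comes for
free, since the sum of (d - i) D_i is the deterministic number m.  Only two
facts are therefore needed: the ratios D_j / D_(j-1) are close to x/j, and x is
asymptotic to log n.

Ratios.  The imbalance S_j = j D_j - x D_(j-1) has drift
(2/u) (S_(j-1) - S_j) up to lower order terms.  As 2/u >= 2/m holds for every
graph, the second moment of S_j is contracted faster than m decreases, and
E S_j^2 = O(m log^2 n) follows by induction on j, without any knowledge of
where the process is ([expect_imbalance_sq]).

Clock.  Since u <= m, the clock is at least the sum of the 2/m, which is about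
log(n/m).  The difference 2/u - 2/m is caused by the vertices of degree at most
d - 2; small imbalances force these to be a fraction O(1/x) of all unsaturated
vertices, so the clock exceeds its minimum by o(log n), except for an excess of
small expectation ([expect_excess]).

These two facts are used at the time when t0 = log^A n edges remain.  All error
terms are then smaller than any prescribed power of 1 / log n, provided that A
is large, and outside an event of that probability D_j is within a factor
1 + O(eta) of f_j ([regular_profile], [expect_le_regular], [expect_ge_regular]).

From t0 to t the clock moves only by O(log log n).  Give a vertex of degree
i <= j the weight r^-(j-i), where r = 1 / (eta log n).  A hit multiplies the
weight of a vertex by r or by 0, so the expected product of the weights of k vertices
decays essentially like m^k ([expect_degweight_le]); its sum over all k-tuples
dominates the factorial moment of D_j ([expect_ffact_upper]).  For the lower
bound it suffices to follow the k-tuples of vertices of degree exactly j that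
are never hit.  They are hit more often than 2k/m only through the vertices of
degree at most d - 2, whose contribution is controlled by the upper bound for
k + 1 vertices ([expect_ffact_lower]).

Throughout, eta is a fixed small number: the ratio in the theorem is shown to be
eventually within O(eta) of 1, for every such eta ([moment_ratio_bound]). *)

(** * Counting available pairs *)

Section OneStep.
Variables (d n : nat).
Implicit Types (G : graph n) (v : 'I_n) (e : {set 'I_n}).

Definition unsat G : {set 'I_n} := [set v | (deg G v < d)%N].

Definition deficit G : nat := (\sum_v (d - deg G v))%N.

Definition pairs_at G v : {set {set 'I_n}} := [set e in available d G | v \in e].

Definition wf_graph G : Prop :=
  (forall e, e \in G -> #|e| = 2%N) /\ (forall v, (deg G v <= d)%N).

Lemma in_unsat G v : (v \in unsat G) = (deg G v < d)%N.
Proof. by rewrite inE. Qed.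

Lemma availableP G e : reflect
  [/\ #|e| = 2%N, e \notin G & forall v, v \in e -> v \in unsat G]
  (e \in available d G).
Proof.
rewrite inE; apply: (iffP and3P) => [[/eqP e2 eG /'forall_implyP eU]|[e2 eG eU]].
  by split=> // v /eU; rewrite in_unsat.
split=> //; first exact/eqP.
by apply/'forall_implyP => v /eU; rewrite in_unsat.
Qed.

Lemma deg_add G e v : e \notin G -> deg (e |: G)%SET v = (deg G v + (v \in e))%N.
Proof.
move=> eG; rewrite /deg.
case: (boolP (v \in e)) => ve.
  have -> : [set e0 in (e |: G)%SET | v \in e0]%SET
            = (e |: [set e0 in G | v \in e0])%SET.
    by apply/setP => e'; rewrite !inE; case: eqP => [->|]; rewrite ?ve.
  by rewrite cardsU1 inE (negbTE eG) /= addnC.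
rewrite addn0; congr #|pred_of_set _|; apply/setP => e'; rewrite !inE.
by case: eqP => [->|]; rewrite ?(negbTE ve) ?andbF.
Qed.

Lemma sum_deg G : (forall e, e \in G -> #|e| = 2%N) -> (\sum_v deg G v = 2 * #|G|)%N.
Proof.
move=> G2.
under eq_bigr do rewrite /deg -sum1_card.
transitivity (\sum_(e in G) \sum_(v in e) 1)%N.
  rewrite (exchange_big_dep (mem G)) /= => [|v e _]; last by rewrite inE => /andP[].
  apply: eq_bigr => e eG; apply: eq_bigl => v; by rewrite inE eG.
under eq_bigr => e eG do rewrite sum1_card (G2 _ eG).
by rewrite sum_nat_const mulnC.
Qed.

Lemma deficitE G : wf_graph G -> (deficit G + 2 * #|G| = d * n)%N.
Proof.
case=> G2 Gd; rewrite -sum_deg // /deficit -big_split /=.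
under eq_bigr do rewrite subnK //.
by rewrite sum_nat_const card_ord mulnC.
Qed.

Lemma card_unsat_le G : (#|unsat G| <= deficit G)%N.
Proof.
rewrite -sum1_card /deficit big_mkcond /=; apply: leq_sum => v _.
by rewrite in_unsat -subn_gt0; case: ifP.
Qed.

Lemma deficit_le_unsat G : (deficit G <= d * #|unsat G|)%N.
Proof.
rewrite -sum1_card big_distrr /= /deficit big_mkcond [leqRHS]big_mkcond /=.
apply: leq_sum => v _; rewrite in_unsat muln1; case: ltnP => // ?; lia.
Qed.

Lemma wf_graph_add G e : wf_graph G -> e \in available d G -> wf_graph (e |: G)%SET.
Proof.
move=> [G2 Gd] /availableP[e2 eG eU]; split=> [e'|v].
  by rewrite !inE => /orP[/eqP->|/G2].
rewrite deg_add //; case: (boolP (v \in e)) => [/eU|_]; rewrite ?addn0 //.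
by rewrite in_unsat addn1.
Qed.

(** A pair at [v] is determined by its other end.  This end can be any unsaturated
vertex other than [v], except for the neighbours of [v], of which there are
fewer than [d]. *)
Lemma card_pairs_at_unsat G v : (forall e, e \in G -> #|e| = 2%N) -> v \in unsat G ->
  (#|unsat G| <= #|pairs_at G v| + d)%N /\ (#|pairs_at G v| < #|unsat G|)%N.
Proof.
move=> G2 vU.
pose Wn := [set w in unsat G | (w != v) && ([set v; w]%SET \notin G)]%SET.
pose Wb := [set w in unsat G | (w != v) && ([set v; w]%SET \in G)]%SET.
have inj2 : {in [pred w | w != v] &, injective (fun w => [set v; w]%SET)}.
  move=> w w'; rewrite !inE => wv w'v /setP /(_ w).
  by rewrite !inE (negbTE wv) eqxx /= => /esym/eqP.
have EP : pairs_at G v = (fun w => [set v; w]%SET) @: Wn.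
  apply/setP => e; apply/idP/imsetP.
    rewrite inE => /andP[/availableP[e2 eG eU] ve].
    have /cards2P[a [b [ab eab]]] : #|e| == 2%N by apply/eqP.
    have [w [wv ew]] : exists w, w != v /\ e = [set v; w]%SET.
      move: ve; rewrite eab !inE => /orP[/eqP->|/eqP->].
        by exists b; rewrite eq_sym.
      by exists a; rewrite finset.setUC.
    exists w => //; rewrite inE wv -ew eG andbT /=.
    by rewrite andbT eU // ew !inE eqxx orbT.
  case=> w; rewrite inE => /and3P[wU wv wG] ->; rewrite inE; apply/andP.
  split; last by rewrite !inE eqxx.
  apply/availableP; split=> //; first by rewrite cards2 eq_sym wv.
  by move=> x; rewrite !inE => /orP[/eqP->|/eqP->]; rewrite -in_unsat.
have cP : #|pairs_at G v| = #|Wn|.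
  rewrite EP card_in_imset // => w w' /= wW w'W; apply: inj2.
    by move: wW; rewrite inE => /and3P[].
  by move: w'W; rewrite inE => /and3P[].
have cWb : (#|Wb| <= deg G v)%N.
  rewrite /deg -(card_in_imset (f := fun w => [set v; w]%SET) (D := Wb)).
    apply: subset_leq_card; apply/fintype.subsetP => e /imsetP[w].
    by rewrite inE => /and3P[_ _ eG] ->; rewrite inE eG !inE eqxx.
  move=> w w' wW w'W; apply: inj2.
    by move: wW; rewrite inE => /and3P[].
  by move: w'W; rewrite inE => /and3P[].
have cU : (#|unsat G| = 1 + (#|Wn| + #|Wb|))%N.
  rewrite (cardsD1 v) vU; congr addn.
  have WI : Wn :&: Wb = finset.set0.
    by apply/setP => w; rewrite !inE; case: (_ \in G); rewrite ?andbF.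
  rewrite -cardsUI WI cards0 addn0; apply: eq_card => w; rewrite !inE.
  by case: (w == v); rewrite ?andbF //=; case: (_ \in G); rewrite ?andbF ?orbF ?andbT.
move: vU; rewrite in_unsat => vd.
rewrite cP; lia.
Qed.

Lemma pairs_at_sat G v : v \notin unsat G -> pairs_at G v = finset.set0.
Proof.
move=> vU; apply/setP => e; rewrite inE finset.in_set0.
by apply/negP => /andP[/availableP[_ _ eU] /eU]; apply/negP.
Qed.

Lemma sum_pairs_at G : (\sum_(v in unsat G) #|pairs_at G v| = 2 * #|available d G|)%N.
Proof.
transitivity (\sum_v #|pairs_at G v|)%N.
  rewrite [RHS](bigID (mem (unsat G))) /= [X in (_ + X)%N]big1 ?addn0 // => v vU.
  by rewrite pairs_at_sat ?cards0.
under eq_bigr do rewrite -sum1_card.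
transitivity (\sum_(e in available d G) \sum_(v in e) 1)%N.
  rewrite (exchange_big_dep (mem (available d G))) /= => [|v e _]; last by rewrite inE => /andP[].
  apply: eq_bigr => e eG; apply: eq_bigl => v; by rewrite inE eG.
under eq_bigr => e eG.
  have /availableP[e2 _ _] := eG.
  rewrite sum1_card e2; over.
by rewrite sum_nat_const mulnC.
Qed.

(** Count the pairs by their two ends: each of the u unsaturated vertices lies in
between u - d and u - 1 of them. *)
Lemma card_available G : (forall e, e \in G -> #|e| = 2%N) ->
  (#|unsat G| * #|unsat G| <= 2 * #|available d G| + #|unsat G| * d)%N /\
  (2 * #|available d G| + #|unsat G| <= #|unsat G| * #|unsat G|)%N.
Proof.
move=> G2; rewrite -sum_pairs_at; split.
  rewrite -!sum_nat_const -big_split /=; apply: leq_sum => v vU.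
  by have [] := card_pairs_at_unsat G2 vU.
rewrite -[X in (_ + X)%N]sum1_card -big_split /= -sum_nat_const.
by apply: leq_sum => v vU; rewrite addn1; have [] := card_pairs_at_unsat G2 vU.
Qed.

Lemma num_deg_le_unsat G i : (i < d)%N -> (num_deg i G <= #|unsat G|)%N.
Proof.
move=> id; apply: subset_leq_card; apply/fintype.subsetP => v.
by rewrite !inE => /eqP->.
Qed.

End OneStep.

(** * Averages, the clocked process and one step of it *)

Section Average.
Variables (R : realType) (T : finType).
Implicit Types (A : {set T}) (f g : T -> R).

Definition avg A f : R := (\sum_(e in A) f e) / #|A|%:R.

Lemma avgD A f g : avg A (fun e => f e + g e) = avg A f + avg A g.
Proof. by rewrite /avg big_split mulrDl. Qed.

Lemma avgZ A c f : avg A (fun e => c * f e) = c * avg A f.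
Proof. by rewrite /avg -mulr_sumr mulrA. Qed.

Lemma avg_sum A (I : finType) (P : pred I) (F : I -> T -> R) :
  avg A (fun e => \sum_(i | P i) F i e) = \sum_(i | P i) avg A (F i).
Proof. by rewrite /avg exchange_big /= mulr_suml. Qed.

Lemma avg_cst A c : A != finset.set0 -> avg A (fun=> c) = c.
Proof.
rewrite -card_gt0 => A0; rewrite /avg sumr_const -[c *+ _]mulr_natr mulfK //.
by rewrite pnatr_eq0 -lt0n.
Qed.

Lemma avg_le A f g : (forall e, e \in A -> f e <= g e) -> avg A f <= avg A g.
Proof. by move=> fg; apply: ler_wpM2r (ler_sum _ fg); rewrite invr_ge0. Qed.

Lemma eq_avg A f g : (forall e, e \in A -> f e = g e) -> avg A f = avg A g.
Proof. by move=> fg; congr (_ / _); apply: eq_bigr. Qed.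

End Average.

Section Chain.
Variables (R : realType) (d n : nat).
Implicit Types (G : graph n) (v : 'I_n) (e : {set 'I_n}) (F : R -> graph n -> R).

(** The one-step Markov operator, acting on functions of the clock and the graph.
The clock belongs to the state because its increments depend on the past of the
process; 2/u is to first order the chance that a given unsaturated vertex is hit. *)
Definition advance F : R -> graph n -> R := fun x G =>
  if available d G == finset.set0 then F x G
  else avg (available d G) (fun e => F (x + 2 / #|unsat d G|%:R) (e |: G)%SET).

Definition expect (s : nat) F : R := iter s advance F 0 finset.set0.

Lemma expectS s F : expect s.+1 F = expect s (advance F).
Proof. by rewrite /expect iterSr. Qed.

(** The clock does not influence the graph. *)
Lemma expect_dprocess_E s (X : graph n -> R) :
  dprocess_E d s X = expect s (fun=> X).
Proof.
pose stp (Y : graph n -> R) G := \sum_H dprocess_step R d G H * Y H.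
have advanceE Y : advance (fun=> Y) = fun=> stp Y.
  apply/funext => x; apply/funext => G; rewrite /advance /stp /dprocess_step.
  case: ifP => A0.
    rewrite (bigD1 G) //= eqxx mul1r big1 ?addr0 // => H /negbTE ->.
    by rewrite mul0r.
  under [RHS]eq_bigr do rewrite -mulr_suml mulrAC mulr_suml.
  rewrite -[RHS]mulr_suml exchange_big /= /avg; congr (_ / _).
  apply: eq_bigr => e eA; rewrite (bigD1 (e |: G)%SET) //= eqxx mul1r big1 ?addr0 //.
  by move=> H /negbTE ->; rewrite mul0r.
elim: s X => [|s IH] X.
  rewrite /dprocess_E /expect /= (bigD1 finset.set0) //= eqxx mul1r big1 ?addr0 //.
  by move=> G /negbTE ->; rewrite mul0r.
rewrite expectS advanceE -IH /dprocess_E /=.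
under eq_bigr do rewrite mulr_suml.
rewrite exchange_big /=; apply: eq_bigr => G _.
by rewrite /stp mulr_sumr; apply: eq_bigr => H _; rewrite mulrA.
Qed.

Lemma advanceD F F' : advance (fun x G => F x G + F' x G) = fun x G => advance F x G + advance F' x G.
Proof.
by apply/funext => x; apply/funext => G; rewrite /advance; case: ifP => // _; rewrite avgD.
Qed.

Lemma advanceZ c F : advance (fun x G => c * F x G) = fun x G => c * advance F x G.
Proof.
by apply/funext => x; apply/funext => G; rewrite /advance; case: ifP => // _; rewrite avgZ.
Qed.

Lemma expectD s F F' : expect s (fun x G => F x G + F' x G) = expect s F + expect s F'.
Proof.
by elim: s F F' => // s IH F F'; rewrite !expectS advanceD IH.
Qed.

Lemma expectZ s c F : expect s (fun x G => c * F x G) = c * expect s F.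
Proof.
by elim: s F => // s IH F; rewrite !expectS advanceZ IH.
Qed.

Lemma expect_cst s c : expect s (fun _ _ => c) = c.
Proof.
elim: s c => // s IH c; rewrite expectS -[RHS]IH; congr (expect _ _).
by apply/funext => x; apply/funext => G; rewrite /advance; case: ifPn => // ?; rewrite avg_cst.
Qed.

Lemma expect_sum s (I : Type) (r : seq I) (P : pred I) (F : I -> R -> graph n -> R) :
  expect s (fun x G => \sum_(i <- r | P i) F i x G)
  = \sum_(i <- r | P i) expect s (F i).
Proof.
elim: r => [|i r IH].
  rewrite big_nil -[RHS](expect_cst s); congr (expect _ _).
  by apply/funext => x; apply/funext => G; rewrite big_nil.
rewrite big_cons -IH; case: ifP => Pi; last first.
  by congr (expect _ _); apply/funext => x; apply/funext => G; rewrite big_cons Pi.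
rewrite -expectD; congr (expect _ _).
by apply/funext => x; apply/funext => G; rewrite big_cons Pi.
Qed.

Definition deficit_after (s : nat) : nat := (d * n - 2 * s)%N.

(** The clock would have this value if [u] were equal to the deficit at all times;
as [u] is at most the deficit, the clock never runs behind it. *)
Definition min_clock (s : nat) : R := \sum_(i < s) 2 / (deficit_after i)%:R.

Lemma min_clock0 : min_clock 0 = 0.
Proof. by rewrite /min_clock big_ord0. Qed.

Lemma min_clockS s : min_clock s.+1 = min_clock s + 2 / (deficit_after s)%:R.
Proof. by rewrite /min_clock big_ord_recr. Qed.

Lemma min_clock_ge0 s : 0 <= min_clock s.
Proof. by apply: sumr_ge0 => i _; rewrite divr_ge0. Qed.

Definition reachable (s : nat) (x : R) G : Prop :=
  [/\ wf_graph d G, #|G| = s & min_clock s <= x <= d%:R * min_clock s].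

Lemma reachable0 : reachable 0 0 finset.set0.
Proof.
split; rewrite ?cards0 // ?min_clock0 ?mulr0 ?lexx //.
split=> [e|v]; first by rewrite inE.
suff -> : deg (finset.set0 : graph n) v = 0 by [].
by apply/eqP; rewrite cards_eq0; apply/eqP/setP => e; rewrite !inE.
Qed.

Hypothesis d_ge2 : (2 <= d)%N.

Section AtGraph.
Variable G : graph n.
Hypothesis Gwf : wf_graph d G.
Hypothesis Gbig : (2 * d * d <= deficit d G)%N.
Let u : R := #|unsat d G|%:R.
Let m : R := (deficit d G)%:R.
Let A := available d G.
Let a : R := #|A|%:R.

Lemma unsat_ge2d : (2 * d <= #|unsat d G|)%N.
Proof. have := deficit_le_unsat d G; nia. Qed.

Lemma unsat_ge4 : 4 <= u.
Proof. by rewrite /u ler_nat; have := unsat_ge2d; lia. Qed.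

Lemma unsat_ge2d_real : 2 * d%:R <= u.
Proof. by rewrite /u -natrM ler_nat unsat_ge2d. Qed.

Lemma unsat_le_deficit : u <= m.
Proof. by rewrite ler_nat card_unsat_le. Qed.

Lemma deficit_le_unsatR : m <= d%:R * u.
Proof. by rewrite -natrM ler_nat deficit_le_unsat. Qed.

Lemma card_available_lower : u * (u - d%:R) <= 2 * a.
Proof.
have [+ _] := card_available d Gwf.1.
by rewrite -(ler_nat R) natrD !natrM -/u -/a => ?; lra.
Qed.

Lemma card_available_upper : 2 * a <= u * (u - 1).
Proof.
have [_ +] := card_available d Gwf.1.
by rewrite -(ler_nat R) natrD !natrM -/u -/a => ?; lra.
Qed.

Lemma available_lower_sq : u ^+ 2 <= 4 * a.
Proof. by have := unsat_ge2d_real; have := unsat_ge4; have := card_available_lower; nra. Qed.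

Lemma available_neq0 : A != finset.set0.
Proof.
rewrite -card_gt0 -(ltr_nat R) -/a.
by have := unsat_ge4; have := available_lower_sq; nra.
Qed.

Lemma advanceE F x : advance F x G = avg A (fun e => F (x + 2 / u) (e |: G)%SET).
Proof. by rewrite /advance (negbTE available_neq0). Qed.

Definition pick_prob v : R := avg A (fun e : {set 'I_n} => (v \in e)%:R).

Lemma pick_probE v : pick_prob v = #|pairs_at d G v|%:R / a.
Proof.
rewrite /pick_prob /avg -natr_sum; congr (_%:R / _).
rewrite -sum1_card [RHS](eq_bigl (fun e => (e \in A) && (v \in e))) ?big_mkcondr.
  by apply: eq_bigr => e _; case: (v \in e).
by move=> e; rewrite inE.
Qed.

Lemma pick_prob_sat v : v \notin unsat d G -> pick_prob v = 0.
Proof. by move=> vU; rewrite pick_probE pairs_at_sat // cards0 mul0r. Qed.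

(** The numerator is u up to d, and the number of pairs is u^2/2 up to a relative
error of d/u. *)
Lemma pick_prob_unsat v : v \in unsat d G -> `|pick_prob v - 2 / u| <= 4 * d%:R / u ^+ 2.
Proof.
move=> vU; rewrite pick_probE.
have [] := card_pairs_at_unsat Gwf.1 vU.
rewrite -(ler_nat R) -(ltr_nat R) natrD -/u; set c := _%:R => cl cu.
have cu' : c <= u - 1 by move: cu; rewrite /c /u ltr_nat lerBrDr natr1 ler_nat.
have d2 : 2 <= d%:R :> R by rewrite ler_nat.
have u4 := unsat_ge4; have ud := unsat_ge2d_real.
have al := card_available_lower; have au := card_available_upper.
have a0 : 0 < a by nra.
have u0 : 0 < u by lra.
have -> : c / a - 2 / u = (c * u - 2 * a) / (a * u).
  by field; rewrite !gt_eqF.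
rewrite normrM normfV (gtr0_norm (x := a * u)) ?mulr_gt0 //.
rewrite ler_pdivrMr ?mulr_gt0 //.
have -> : 4 * d%:R / u ^+ 2 * (a * u) = 4 * d%:R * a / u.
  by field; rewrite gt_eqF.
have h := available_lower_sq.
have cua : `|c * u - 2 * a| <= u * (d%:R - 1).
  by rewrite ler_norml; apply/andP; split; nra.
by rewrite ler_pdivlMr //; nra.
Qed.

Lemma avg_sum_edge (b : 'I_n -> R) :
  avg A (fun e : {set 'I_n} => \sum_(v in e) b v) = \sum_(v in unsat d G) pick_prob v * b v.
Proof.
transitivity (\sum_v pick_prob v * b v).
  under eq_bigr do rewrite mulrC -avgZ.
  rewrite -avg_sum; apply: eq_avg => e _; rewrite big_mkcond /=.
  by apply: eq_bigr => v _; case: ifP; rewrite ?mulr1 ?mulr0.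
rewrite [LHS](bigID (mem (unsat d G))) /= [X in _ + X]big1 ?addr0 // => v vU.
by rewrite pick_prob_sat ?mul0r.
Qed.

End AtGraph.
End Chain.

(** * Monotonicity of expectations and imbalances *)

Section Monotone.
Variables (R : realType) (d n : nat).
Hypothesis d_ge2 : (2 <= d)%N.
Implicit Types (G : graph n) (v : 'I_n) (e : {set 'I_n}) (F : R -> graph n -> R).

(** The deficit is a function of time; this is what makes it usable as a scale for
all the random quantities below. *)
Lemma deficit_reachable s (x : R) G : reachable d s x G -> deficit d G = deficit_after d n s.
Proof. by case=> /deficitE E <- _; rewrite /deficit_after /deficit_after; lia. Qed.

(** The increment 2/u lies between 2/m and d times that, by the bounds on u. *)
Lemma reachable_step s (x : R) G e : reachable d s x G -> (2 * d * d <= deficit_after d n s)%N ->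
  e \in available d G -> reachable d s.+1 (x + 2 / #|unsat d G|%:R) (e |: G)%SET.
Proof.
move=> Gr big eA; have E := deficit_reachable Gr.
case: Gr => Gwf cG /andP[xl xu].
split; first exact: wf_graph_add.
  by have /availableP[_ eG _] := eA; rewrite cardsU1 eG cG.
rewrite min_clockS -/(deficit_after d n s) -E.
have Gbig : (2 * d * d <= deficit d G)%N by rewrite E.
have u4 := unsat_ge4 R d_ge2 Gbig; set u : R := #|unsat d G|%:R in u4 *.
have um := unsat_le_deficit R d G; set m : R := (deficit d G)%:R in um *; rewrite -/u in um.
have mu := deficit_le_unsatR R d G; rewrite -/m -/u in mu.
have m0 : 0 < m by lra.
have u0 : 0 < u by lra.
have h1 : 2 / m <= 2 / u by rewrite ler_pM2l // lef_pV2 ?posrE.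
have h2 : 2 / u <= d%:R * (2 / m).
  have -> : d%:R * (2 / m) = 2 * d%:R / m by ring.
  by rewrite ler_pdivlMr // mulrAC ler_pdivrMr // -[2 * d%:R * u]mulrA ler_pM2l.
by apply/andP; split; [lra | rewrite mulrDr; lra].
Qed.

Lemma advance_le s (x : R) G F F' : reachable d s x G -> (2 * d * d <= deficit_after d n s)%N ->
  (forall y H, reachable d s.+1 y H -> F y H <= F' y H) ->
  advance d F x G <= advance d F' x G.
Proof.
move=> Gr big FF; have Gbig : (2 * d * d <= deficit d G)%N by rewrite (deficit_reachable Gr).
have [Gwf _ _] := Gr; rewrite !(advanceE d_ge2) //; apply: avg_le => e eA; apply: FF.
exact: reachable_step.
Qed.

(** Reachable states remain reachable as long as the deficit keeps the process from
stopping. *)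
Lemma expect_le s F F' : (2 * d * d <= deficit_after d n s)%N ->
  (forall x G, reachable d s x G -> F x G <= F' x G) ->
  expect d s F <= expect d s F'.
Proof.
elim: s F F' => [|s IH] F F' big FF; first exact/FF/reachable0.
have big' : (2 * d * d <= deficit_after d n s)%N.
  by apply: leq_trans big _; rewrite /deficit_after /deficit_after; lia.
by rewrite !expectS; apply: IH => // x G Gr; apply: advance_le Gr _ FF.
Qed.

Lemma expect_step s F F' : (2 * d * d <= deficit_after d n s)%N ->
  (forall x G, reachable d s x G -> advance d F x G <= F' x G) ->
  expect d s.+1 F <= expect d s F'.
Proof. by move=> big FF; rewrite expectS; exact: expect_le. Qed.

End Monotone.

Section Imbalance.
Variables (R : realType) (d n : nat).
Hypothesis d_ge2 : (2 <= d)%N.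
Implicit Types (G : graph n) (v : 'I_n) (e : {set 'I_n}) (F : R -> graph n -> R).

(** If the number of vertices of degree i were proportional to x^i/i!, then
j D_j - x D_(j-1) would vanish for all j.  The indices are shifted so that [imbalance 0]
is identically 0, which starts the induction on [j]. *)
Definition imbalance_weight (j : nat) (x : R) (i : nat) : R :=
  j%:R * (i == j)%:R - x * (i.+1 == j)%:R.

Definition imbalance j x G : R := \sum_v imbalance_weight j x (deg G v).

Lemma num_deg_sum j G : (num_deg j G)%:R = \sum_v (deg G v == j)%:R :> R.
Proof.
rewrite /num_deg -sum1_card natr_sum big_mkcond /=.
by apply: eq_bigr => v _; rewrite inE; case: eqP.
Qed.

Lemma imbalance0 x G : imbalance 0 x G = 0.
Proof. by apply: big1 => v _; rewrite /imbalance_weight mul0r mulr0 subrr. Qed.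

Lemma imbalanceS j x G : imbalance j.+1 x G = j.+1%:R * (num_deg j.+1 G)%:R - x * (num_deg j G)%:R.
Proof. by rewrite !num_deg_sum !mulr_sumr -sumrB. Qed.

Lemma sum_deg_add G e (w : nat -> R) : e \in available d G ->
  \sum_v w (deg (e |: G)%SET v)
  = \sum_v w (deg G v) + \sum_(v in e) (w (deg G v).+1 - w (deg G v)).
Proof.
case/availableP=> _ eG _; rewrite [X in _ + X]big_mkcond -big_split /=.
apply: eq_bigr => v _; rewrite deg_add //; case: ifP => _; rewrite ?addn1 ?addn0 ?addr0 //.
by rewrite addrC subrK.
Qed.

Lemma sum_unsat_support G (b : nat -> R) : wf_graph d G -> b d = 0 ->
  \sum_(v in unsat d G) b (deg G v) = \sum_v b (deg G v).
Proof.
move=> [_ Gd] bd; rewrite [RHS](bigID (mem (unsat d G))) /= [X in _ + X]big1 ?addr0 //.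
move=> v; rewrite in_unsat -leqNgt => dv.
by have /eqP -> : deg G v == d by rewrite eqn_leq Gd dv.
Qed.

(** There are u unsaturated vertices, each with a hitting probability that is off by
O(1/u^2). *)
Lemma avg_sum_edge_approx G (b : 'I_n -> R) B : wf_graph d G ->
  (2 * d * d <= deficit d G)%N -> (forall v, v \in unsat d G -> `|b v| <= B) ->
  `|avg (available d G) (fun e : {set 'I_n} => \sum_(v in e) b v)
    - 2 / #|unsat d G|%:R * \sum_(v in unsat d G) b v| <= 4 * d%:R * B / #|unsat d G|%:R.
Proof.
move=> Gwf Gbig bB; rewrite avg_sum_edge mulr_sumr -sumrB.
have u4 := unsat_ge4 R d_ge2 Gbig.
apply: le_trans (ler_norm_sum _ _ _) _.
apply: (@le_trans _ _ (\sum_(v in unsat d G) (4 * d%:R / #|unsat d G|%:R ^+ 2 * B))).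
  apply: ler_sum => v vU; rewrite -mulrBl normrM.
  by apply: ler_pM (bB _ vU) => //; apply: pick_prob_unsat.
rewrite sumr_const -[_ *+ #|_|]mulr_natr le_eqVlt; apply/orP; left; apply/eqP.
by field; rewrite gt_eqF //; lra.
Qed.

(** Squaring doubles the drift, which gives the contraction 4/u.  The cross terms with
[S0] and with the drift error cost 1/2 each by the inequality between means, and
3/u remains. *)
Lemma sq_drift (u dd B S S0 D V : R) : 2 <= dd -> 2 * dd <= u -> 0 <= B ->
  `|D - 2 / u * (S0 - S)| <= 5 * dd * B / u -> V <= 9 * B ^+ 2 ->
  S ^+ 2 + 2 * S * D + V
  <= (1 - 3 / u) * S ^+ 2 + 8 / u * S0 ^+ 2 + 34 * dd * B ^+ 2.
Proof.
move=> d2 du B0; set r := u^-1.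
have u0 : 0 < u by lra.
have r0 : 0 < r by rewrite invr_gt0.
have rd : r * dd <= 1 / 2 by rewrite /r mulrC ler_pdivrMr //; lra.
rewrite ler_norml => /andP[Dl Du] HV.
set E := D - _ in Dl Du.
have HD : D = E + 2 * r * (S0 - S) by rewrite /E; ring.
have SE : S * E <= `|S| * (5 * dd * B * r).
  apply: le_trans (ler_norm _) _; rewrite normrM ler_wpM2l //.
  by rewrite ler_norml Dl Du.
have SS : `|S| ^+ 2 = S ^+ 2 by rewrite real_normK // num_real.
set aS := `|S| in SE SS.
have q1 : 0 <= r * (aS - 10 * dd * B) ^+ 2 by rewrite mulr_ge0 ?sqr_ge0 // ltW.
have q2 : 0 <= r * (S - 4 * S0) ^+ 2 by rewrite mulr_ge0 ?sqr_ge0 // ltW.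
have q3 : r * dd * (dd * B ^+ 2) <= 1 / 2 * (dd * B ^+ 2).
  by rewrite ler_wpM2r // mulr_ge0 ?sqr_ge0 //; lra.
have q4 : 0 <= (dd - 1) * B ^+ 2 by rewrite mulr_ge0 ?sqr_ge0 //; lra.
rewrite HD; nra.
Qed.

End Imbalance.

Section ImbalanceBound.
Variables (R : realType) (d n : nat).
Hypothesis d_ge2 : (2 <= d)%N.
Implicit Types (G : graph n) (v : 'I_n) (e : {set 'I_n}) (F : R -> graph n -> R).

(** The weights were chosen so that the change of degrees and the change of the clock
combine exactly: summing the increments over all vertices gives
[imbalance j - imbalance j.+1]. *)
Lemma imbalance_advance j (x : R) G : wf_graph d G -> (2 * d * d <= deficit d G)%N ->
  0 <= x -> (j.+1 < d)%N ->
  advance d (fun y H => imbalance j.+1 y H ^+ 2) x G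
  <= (1 - 3 / #|unsat d G|%:R) * imbalance j.+1 x G ^+ 2
     + 8 / #|unsat d G|%:R * imbalance j x G ^+ 2 + 34 * d%:R * (d%:R + 1 + x) ^+ 2.
Proof.
move=> Gwf Gbig x0 jd; rewrite advanceE //.
have u4 := unsat_ge4 R d_ge2 Gbig; have ud := unsat_ge2d_real R d_ge2 Gbig.
set u : R := #|unsat d G|%:R in u4 ud *.
set h := 2 / u; set x' := x + h; set B := d%:R + 1 + x.
have u0 : 0 < u by lra.
have h0 : 0 < h by rewrite divr_gt0.
have h1 : h <= 1 by rewrite /h ler_pdivrMr //; lra.
have hu : h * u = 2 by rewrite /h divfK // gt_eqF.
have d2 : 2 <= d%:R :> R by rewrite ler_nat.
have jd1 : j.+1%:R + 1 <= d%:R :> R by rewrite natr1 ler_nat.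
have j0 : 0 <= j.+1%:R :> R by [].
pose S := imbalance j.+1 x G; pose S0 := imbalance j x G.
pose D : R := (num_deg j G)%:R.
pose D1 : R := \sum_v ((deg G v).+1 == j)%:R.
pose b i := imbalance_weight j.+1 x' i.+1 - imbalance_weight j.+1 x' i.
have x'0 : 0 <= x' by rewrite /x'; lra.
have bB i : (i < d)%N -> `|b i| <= B.
  move=> id; rewrite /b /imbalance_weight ler_norml /B /x'.
  rewrite !eqSS.
  case: (eqVneq i j.+1) => [->|ij1].
    by rewrite !gtn_eqF //= mulr0n mulr1n; apply/andP; split; lra.
  case: (eqVneq i j) => [->|ij].
    by rewrite gtn_eqF //= mulr0n mulr1n; apply/andP; split; lra.
  by case: (eqVneq i.+1 j) => _ /=; rewrite ?mulr0n ?mulr1n; apply/andP; split; lra.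
have bd : b d = 0.
  rewrite /b /imbalance_weight !eqSS (gtn_eqF jd) (@gtn_eqF j d) ?(@gtn_eqF j d.+1) //=; last first.
  - exact: ltnW.
  - exact: ltnW (ltnW _).
  by rewrite mulr0n; ring.
(* The advance of the clock by h takes off h times the number of vertices of degree j. *)
have SE e : e \in available d G ->
    imbalance j.+1 x' (e |: G)%SET = S + (\sum_(v in e) b (deg G v) - h * D).
  move=> eA; rewrite /imbalance (sum_deg_add (d := d)) //.
  have -> : \sum_v imbalance_weight j.+1 x' (deg G v) = S - h * D.
    rewrite /S /imbalance /D num_deg_sum mulr_sumr -sumrB; apply: eq_bigr => v _.
    by rewrite /imbalance_weight /x' eqSS; ring.
  by rewrite /b; ring.
rewrite (eq_avg (g := fun e : {set 'I_n} => S ^+ 2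
   + (2 * S * (\sum_(v in e) b (deg G v) - h * D)
     + (\sum_(v in e) b (deg G v) - h * D) ^+ 2))); last first.
  by move=> e eA; rewrite -/x' (SE e eA); ring.
have A0 := available_neq0 R d_ge2 Gwf Gbig.
rewrite avgD (avg_cst _ A0) avgD avgZ addrA.
have Dn0 : 0 <= D by [].
have D1n0 : 0 <= D1 by apply: sumr_ge0.
have Du : D <= u by rewrite ler_nat num_deg_le_unsat // ltnW.
have D1u : D1 <= u.
  case: j @S0 @S @D @D1 {b bB bd SE jd1 j0 Dn0 Du} jd D1n0 => [|j] S0 S D D1 jd D1n0.
    by rewrite /D1 big1 //; lra.
  by rewrite /D1 -num_deg_sum ler_nat num_deg_le_unsat // ltnW // ltnW.
apply: sq_drift => //; first by rewrite /B; lra.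
  set avD := avg _ _.
  pose avb := avg (available d G) (fun e : {set 'I_n} => \sum_(v in e) b (deg G v)).
  have -> : avD = avb - h * D.
    by rewrite /avD avgD (avg_cst _ A0).
  have := @avg_sum_edge_approx R d n d_ge2 G (fun v => b (deg G v)) B Gwf Gbig.
  rewrite -/avb -/u -/h (sum_unsat_support Gwf bd) => /(_ _)/wrap[].
    by move=> v; rewrite in_unsat; exact: bB.
  have -> : \sum_v b (deg G v) = S0 - h * D1 - S + h * D + D.
    rewrite /S0 /S /imbalance /D /D1 num_deg_sum !mulr_sumr -!sumrB -!big_split /=.
    apply: eq_bigr => v _.
    rewrite /b /imbalance_weight /x' !eqSS -natr1.
    by case: eqVneq => [->|_] /=; ring.
  (* Evaluating at the new clock time costs only this second-order term. *)
  have hhu : h ^+ 2 * u = 4 / u by rewrite /h; field; rewrite gt_eqF.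
  rewrite !ler_norml => /andP[l1 l2].
  have e1 : 5 * d%:R * B / u = 4 * d%:R * B / u + d%:R * B / u by ring.
  have e2 : 4 / u <= d%:R * B / u.
    rewrite ler_pM2r ?invr_gt0 //; apply: (@le_trans _ _ (2 * 2)); first by lra.
    by apply: ler_pM => //; rewrite /B; lra.
  have e3 : h ^+ 2 * D <= h ^+ 2 * u by rewrite ler_wpM2l // sqr_ge0.
  have e4 : h ^+ 2 * D1 <= h ^+ 2 * u by rewrite ler_wpM2l // sqr_ge0.
  have e5 : 0 <= h ^+ 2 * D by rewrite mulr_ge0 // sqr_ge0.
  have e6 : 0 <= h ^+ 2 * D1 by rewrite mulr_ge0 // sqr_ge0.
  by rewrite e1 -/S0; apply/andP; split; lra.
have B0 : 3 <= B by rewrite /B; lra.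
apply: (@le_trans _ _ (avg (available d G) (fun=> 9 * B ^+ 2))); last first.
  by rewrite (avg_cst _ A0).
apply: avg_le => e eA.
have /availableP[e2 _ eU] := eA.
have : `|\sum_(v in e) b (deg G v)| <= 2 * B.
  apply: le_trans (ler_norm_sum _ _ _) _.
  apply: (@le_trans _ _ (\sum_(v in e) B)).
    by apply: ler_sum => v /eU; rewrite in_unsat; exact: bB.
  by rewrite sumr_const e2 -[B *+ 2]mulr_natl.
have hD : h * D <= 2 by rewrite -hu ler_wpM2l // ltW.
have hD0 : 0 <= h * D by rewrite mulr_ge0 // ltW.
rewrite ler_norml => /andP[l1 l2].
set X := _ - _.
have X1 : 0 <= 3 * B - X by rewrite /X; lra.
have X2 : 0 <= 3 * B + X by rewrite /X; lra.
have := mulr_ge0 X1 X2; nra.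
Qed.

Fixpoint imbalance_const (j : nat) : R :=
  if j is j'.+1 then 8 * d%:R * imbalance_const j' + 34 * d%:R else 0.

Lemma imbalance_const_ge0 j : 0 <= imbalance_const j.
Proof. by elim: j => //= j IH; rewrite addr_ge0 // mulr_ge0. Qed.

Lemma deficit_afterS s : (2 * d * d <= deficit_after d n s)%N ->
  (deficit_after d n s.+1)%:R = (deficit_after d n s)%:R - 2 :> R.
Proof.
move=> big; apply/eqP; rewrite eq_sym subr_eq -natrD eqr_nat; apply/eqP.
by move: big; rewrite /deficit_after; nia.
Qed.

Lemma deficit_after_ge8 s : (2 * d * d <= deficit_after d n s)%N -> 8 <= (deficit_after d n s)%:R :> R.
Proof. by move=> big; rewrite (ler_nat _ 8); nia. Qed.

Lemma min_clock_mono s s' : (s <= s')%N -> min_clock R d n s <= min_clock R d n s'.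
Proof.
elim: s' => [|s' IH]; first by rewrite leqn0 => /eqP->.
rewrite leq_eqVlt ltnS => /orP[/eqP->//|/IH h].
by rewrite min_clockS (le_trans h) // lerDl divr_ge0.
Qed.

(** Both the contraction 1 - 3/m and the source terms use only deterministic bounds on
u.  The deficit itself shrinks by the factor 1 - 2/m, more slowly than the second
moment is contracted, so a bound proportional to the deficit is stable. *)
Lemma expect_imbalance_sq j s B : (j < d)%N -> (2 * d * d <= deficit_after d n s)%N ->
  d%:R + 1 + d%:R * min_clock R d n s <= B ->
  expect d s (fun x G => imbalance (n:=n) j x G ^+ 2) <= imbalance_const j * B ^+ 2 * (deficit_after d n s)%:R.
Proof.
elim: j s => [|j IHj] s jd; elim: s => [|s IHs] big sB.
- by rewrite /expect /= imbalance0 expr0n /= !mul0r.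
- rewrite /= !mul0r -(expect_cst d n s.+1 0); apply: expect_le => // x G _.
  by rewrite imbalance0 expr0n.
- rewrite /expect /= imbalanceS mul0r subr0.
  have -> : num_deg j.+1 (finset.set0 : graph n) = 0%N.
    apply/eqP; rewrite cards_eq0; apply/eqP/setP => v; rewrite !inE.
    suff -> : deg (finset.set0 : graph n) v = 0%N by [].
    by apply/eqP; rewrite cards_eq0; apply/eqP/setP => e; rewrite !inE.
  rewrite mulr0 expr0n /=; apply: mulr_ge0 => //; apply: mulr_ge0; last exact: sqr_ge0.
  exact: imbalance_const_ge0 j.+1.
have big' : (2 * d * d <= deficit_after d n s)%N.
  by apply: leq_trans big _; rewrite /deficit_after; lia.
have sB' : d%:R + 1 + d%:R * min_clock R d n s <= B.
  by apply: le_trans sB; rewrite lerD2l ler_wpM2l // min_clock_mono.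
have {IHs} Hs := IHs big' sB'; have {IHj} Hj := IHj s (ltnW jd) big' sB'.
rewrite deficit_afterS //; have := deficit_after_ge8 big'.
set m : R := (deficit_after d n s)%:R in Hs Hj * => m8.
have d0 : 0 < d%:R :> R by rewrite ltr0n; lia.
pose F x (G : graph n) := (1 - 3 / m) * imbalance j.+1 x G ^+ 2
   + (8 * d%:R / m * imbalance j x G ^+ 2 + 34 * d%:R * B ^+ 2) : R.
apply: (@le_trans _ _ (expect d s F)).
  apply: expect_step => // x G Gr.
  have E := deficit_reachable d_ge2 Gr; have [Gwf _ /andP[xl xu]] := Gr.
  have Gbig : (2 * d * d <= deficit d G)%N by rewrite E.
  have x0 : 0 <= x by apply: le_trans xl; exact: min_clock_ge0.
  apply: le_trans (imbalance_advance Gwf Gbig x0 jd) _.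
  have u4 := unsat_ge4 R d_ge2 Gbig.
  have um := unsat_le_deficit R d G; rewrite E -/m in um.
  have mu := deficit_le_unsatR R d G; rewrite E -/m in mu.
  set u : R := #|unsat d G|%:R in u4 um mu *.
  have u0 : 0 < u by apply: lt_le_trans u4.
  have iu : m^-1 <= u^-1 by rewrite lef_pV2 ?posrE //; apply: lt_le_trans um.
  have iu2 : u^-1 <= d%:R / m.
    rewrite ler_pdivlMr; last by apply: lt_le_trans um; apply: lt_le_trans u4.
    by rewrite mulrC ler_pdivrMr //; apply: lt_le_trans u4.
  have iu3 : 0 < m^-1 by rewrite invr_gt0; lra.
  have b1 : 0 <= imbalance j.+1 x G ^+ 2 by rewrite sqr_ge0.
  have b2 : 0 <= imbalance j x G ^+ 2 by rewrite sqr_ge0.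
  have BB : d%:R + 1 + x <= B by lra.
  have b3 : (d%:R + 1 + x) ^+ 2 <= B ^+ 2 by rewrite ler_sqr ?nnegrE; lra.
  rewrite /F -addrA; apply: lerD; first by apply: ler_wpM2r => //; lra.
  apply: lerD; last by apply: ler_wpM2l; lra.
  apply: ler_wpM2r => //.
  have -> : 8 * d%:R / m = 8 * (d%:R / m) by ring.
  by rewrite ler_pM2l.
rewrite /F !expectD !expectZ expect_cst.
have m3 : 0 <= 1 - 3 / m by rewrite subr_ge0 ler_pdivrMr; lra.
have dm : 0 <= 8 * d%:R / m by rewrite divr_ge0 ?mulr_ge0 //; lra.
apply: (le_trans (lerD (ler_wpM2l m3 Hs) (lerD (ler_wpM2l dm Hj) (lexx _)))).
rewrite [imbalance_const j.+1]/=.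
have K0 := imbalance_const_ge0 j; set K := imbalance_const j in K0 *.
have B2 : 0 <= B ^+ 2 by rewrite sqr_ge0.
rewrite le_eqVlt; apply/orP; left; apply/eqP; field.
by rewrite gt_eqF //; lra.
Qed.
End ImbalanceBound.

(** * The clock stays close to its minimum *)

Section ClockExcess.
Variables (R : realType) (d n : nat).
Hypothesis d_ge2 : (2 <= d)%N.
Implicit Types (G : graph n) (v : 'I_n) (e : {set 'I_n}) (F : R -> graph n -> R).

(** Vertices of degree at most d - 2 are the only ones that make the deficit larger
than the number of unsaturated vertices. *)
Definition low G : R := \sum_v ((deg G v).+1 < d)%:R.

Lemma low_ge0 G : 0 <= low G.
Proof. by apply: sumr_ge0. Qed.

Lemma low_num_deg G : low G = \sum_(i < d.-1) (num_deg i G)%:R.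
Proof.
under [RHS]eq_bigr do rewrite num_deg_sum.
rewrite exchange_big /=; apply: eq_bigr => v _.
case: (ltnP (deg G v).+1 d) => dv.
  have lt : (deg G v < d.-1)%N by lia.
  rewrite (bigD1 (Ordinal lt)) //= eqxx big1 ?addr0 // => i ne.
  by case: eqP => // vi; case/eqP: ne; apply/val_inj.
rewrite big1 // => i _; case: eqP => // vi.
by have := ltn_ord i; lia.
Qed.

Lemma deficit_sub_unsat_le G :
  (deficit d G)%:R - #|unsat d G|%:R <= d%:R * low G :> R.
Proof.
have -> : #|unsat d G|%:R = \sum_v (deg G v < d)%:R :> R.
  rewrite -sum1_card natr_sum big_mkcond /=.
  by apply: eq_bigr => v _; rewrite in_unsat; case: ifP.
rewrite /deficit natr_sum -sumrB mulr_sumr.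
apply: ler_sum => v _.
have : (d - deg G v)%:R <= (1 + d * ((deg G v).+1 < d))%:R :> R.
  by rewrite ler_nat; case: ltnP; lia.
case: (ltnP (deg G v) d) => dv /=; first by rewrite mulr1n natrD natrM => h; lra.
by rewrite (_ : (d - deg G v)%N = 0%N) ?mulr0n ?subr0 ?mulr_ge0 //; lia.
Qed.

(** Each x D_i is (i+1) D_(i+1) minus an imbalance, hence at most a multiple of u plus
an imbalance. *)
Lemma low_le_imbalance G (x : R) : 0 <= x ->
  (1 + x) * low G <= d%:R ^+ 2 * #|unsat d G|%:R + \sum_(i < d.-1) `|imbalance i.+1 x G|.
Proof.
move=> x0; rewrite low_num_deg mulr_sumr.
set u : R := #|unsat d G|%:R.
have u0 : 0 <= u by [].
apply: (@le_trans _ _ (\sum_(i < d.-1) (d%:R * u + `|imbalance i.+1 x G|))).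
  apply: ler_sum => i _; have il := ltn_ord i.
  have a1 : (num_deg i G)%:R <= u by rewrite ler_nat num_deg_le_unsat //; lia.
  have a2 : (num_deg i.+1 G)%:R <= u by rewrite ler_nat num_deg_le_unsat //; lia.
  have a3 : i.+1%:R + 1 <= d%:R :> R by rewrite natr1 ler_nat; lia.
  have := ler_norm (- imbalance i.+1 x G); rewrite normrN imbalanceS.
  have : i.+1%:R * (num_deg i.+1 G)%:R <= (d%:R - 1) * u.
    by apply: ler_pM => //; lra.
  lra.
rewrite big_split /= lerD2r sumr_const card_ord -[_ *+ _]mulr_natl.
rewrite mulrA; apply: ler_wpM2r => //; rewrite expr2; apply: ler_wpM2r => //.
by rewrite ler_nat leq_pred.
Qed.

(** The clock is expected to run ahead of its minimum l by the integral of C/(1 + l).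
The square root grows faster than this integral and is still negligible against l,
which is all that matters. *)
Definition clock_slack (s : nat) : R :=
  6 * d%:R ^+ 3 * Num.sqrt (1 + min_clock R d n s).

(** The truncation at 0 makes the excess increase by at most the error term at each
step, whatever the present value of the clock is. *)
Definition excess (s : nat) (x : R) : R :=
  Num.max 0 (x - min_clock R d n s - clock_slack s).

Lemma excess_ge0 s x : 0 <= excess s x.
Proof. by rewrite /excess le_max lexx. Qed.

Lemma clock_slackS s : (2 * d * d <= deficit_after d n s)%N ->
  2 / (deficit_after d n s)%:R * (2 * d%:R ^+ 3) <=
  (clock_slack s.+1 - clock_slack s) * (1 + min_clock R d n s).
Proof.
move=> big; rewrite /clock_slack min_clockS.
have l0 := min_clock_ge0 R d n s; set l := min_clock R d n s in l0 *.
have m8 := deficit_after_ge8 R d_ge2 big; set m : R := (deficit_after d n s)%:R in m8 *.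
set del := 2 / m.
have m0 : 0 < m by lra.
have del0 : 0 < del by rewrite divr_gt0.
have del1 : del <= 1 by rewrite /del ler_pdivrMr; lra.
have a2 : Num.sqrt (1 + l) ^+ 2 = 1 + l by rewrite sqr_sqrtr; lra.
have b2 : Num.sqrt (1 + (l + del)) ^+ 2 = 1 + (l + del) by rewrite sqr_sqrtr; lra.
have a0 := sqrtr_ge0 (1 + l); have b0 := sqrtr_ge0 (1 + (l + del)).
set a := Num.sqrt (1 + l) in a2 a0 *; set b := Num.sqrt _ in b2 b0 *.
rewrite -a2.
have a1 : 1 <= a by nra.
have b2a : b <= 2 * a by nra.
have ba : 0 <= b - a by nra.
have dd : del = (b - a) * (b + a) by nra.
have d0 : 0 <= d%:R ^+ 3 :> R by rewrite exprn_ge0.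
have : del <= 3 * (b - a) * a ^+ 2.
  rewrite dd -[3 * _ * _]mulrA [3 * _]mulrC -mulrA ler_wpM2l //; nra.
move=> /(ler_wpM2r d0); lra.
Qed.

(** This trades the first moment of an imbalance for its second moment, which is the
one that is known. *)
Lemma norm_le_sq (a u : R) : 0 < u -> `|a| <= u * (1 + a ^+ 2 / u ^+ 2).
Proof.
move=> u0; have -> : u * (1 + a ^+ 2 / u ^+ 2) = (u ^+ 2 + a ^+ 2) / u.
  by field; rewrite gt_eqF.
rewrite ler_pdivlMr // -[a ^+ 2]real_normK ?num_real //.
by have := sqr_ge0 (u - `|a|); nra.
Qed.

(** The part of 2/u - 2/m that comes from u times a constant is absorbed by the slack;
the squares of the imbalances remain. *)
Lemma excess_advance s (x : R) G : reachable d s x G -> (2 * d * d <= deficit_after d n s)%N ->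
  excess s.+1 (x + 2 / #|unsat d G|%:R) <=
  excess s x + 2 * d%:R ^+ 3 / (deficit_after d n s)%:R ^+ 3
     * \sum_(i < d.-1) imbalance i.+1 x G ^+ 2.
Proof.
move=> Gr big; have E := deficit_reachable d_ge2 Gr; have [Gwf _ /andP[xl xu]] := Gr.
have Gbig : (2 * d * d <= deficit d G)%N by rewrite E.
have x0 : 0 <= x by apply: le_trans xl; exact: min_clock_ge0.
have u4 := unsat_ge4 R d_ge2 Gbig.
have um := unsat_le_deficit R d G; rewrite E in um.
have mu := deficit_le_unsatR R d G; rewrite E in mu.
have lw := low_le_imbalance G x0.
have dl := deficit_sub_unsat_le G; rewrite E in dl.
have cs := clock_slackS big.
have l0 := min_clock_ge0 R d n s.
have lG := low_ge0 G.
have SE : \sum_(i < d.-1) `|imbalance i.+1 x G| <= #|unsat d G|%:R *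
   (d%:R + \sum_(i < d.-1) imbalance i.+1 x G ^+ 2 / #|unsat d G|%:R ^+ 2).
  apply: (@le_trans _ _ (\sum_(i < d.-1) #|unsat d G|%:R *
     (1 + imbalance i.+1 x G ^+ 2 / #|unsat d G|%:R ^+ 2))).
    by apply: ler_sum => i _; apply: norm_le_sq; lra.
  rewrite -mulr_sumr ler_wpM2l // big_split /= lerD2r sumr_const card_ord.
  by rewrite ler_nat leq_pred.
have [r0 rS] : 0 <= \sum_(i < d.-1) imbalance i.+1 x G ^+ 2 / #|unsat d G|%:R ^+ 2 /\
  \sum_(i < d.-1) imbalance i.+1 x G ^+ 2 / #|unsat d G|%:R ^+ 2 <=
  d%:R ^+ 2 / (deficit_after d n s)%:R ^+ 2 * \sum_(i < d.-1) imbalance i.+1 x G ^+ 2.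
  split; first by apply: sumr_ge0 => i _; rewrite divr_ge0 ?sqr_ge0.
  rewrite mulr_sumr; apply: ler_sum => i _; rewrite mulrC.
  apply: ler_wpM2r; first exact: sqr_ge0.
  set m : R := (deficit_after d n s)%:R in um mu *; set u : R := #|_|%:R in u4 um mu *.
  rewrite ler_pdivlMr; last by rewrite exprn_gt0 //; lra.
  rewrite mulrC ler_pdivrMr; last by rewrite exprn_gt0 //; lra.
  by rewrite -exprMn ler_sqr ?nnegrE; lra.
set T := \sum_(i < d.-1) imbalance i.+1 x G ^+ 2 in rS *.
set Q := \sum_(i < d.-1) _ / _ in SE r0 rS.
set Sa := \sum_(i < d.-1) `|_| in lw SE.
have d2 : 2 <= d%:R :> R by rewrite ler_nat.
set m : R := (deficit_after d n s)%:R in um mu rS dl cs *; set u : R := #|unsat d G|%:R in u4 um mu lw dl SE *.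
set D : R := d%:R in d2 mu lw dl cs SE rS *.
have u0 : 0 < u by lra.
have m0 : 0 < m by lra.
set l := min_clock R d n s in l0 xl cs *.
have k1 : low G * (1 + l) <= u * (2 * D ^+ 2 + Q).
  have : low G * (1 + l) <= (1 + x) * low G by rewrite mulrC; apply: ler_wpM2r => //; lra.
  nra.
have k2 : (m - u) * (1 + l) <= D * (u * (2 * D ^+ 2 + Q)).
  apply: (@le_trans _ _ (D * low G * (1 + l))); first by apply: ler_wpM2r => //; lra.
  by rewrite -mulrA; apply: ler_wpM2l => //; lra.
have k3 : (2 / u - 2 / m) * (1 + l) <= 2 / m * (D * (2 * D ^+ 2 + Q)).
  have -> : (2 / u - 2 / m) * (1 + l) = 2 / m * ((m - u) * (1 + l) / u).
    by field; rewrite !gt_eqF.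
  apply: ler_wpM2l; first by rewrite divr_ge0 //; lra.
  rewrite ler_pdivrMr //; lra.
have k4 : (2 / u - 2 / m) * (1 + l) <=
  (clock_slack s.+1 - clock_slack s + 2 * D ^+ 3 / m ^+ 3 * T) * (1 + l).
  apply: (le_trans k3).
  have e1 : 2 / m * (D * Q) <= 2 * D ^+ 3 / m ^+ 3 * T.
    have -> : 2 * D ^+ 3 / m ^+ 3 * T = 2 / m * (D * (D ^+ 2 / m ^+ 2 * T)).
      by field; rewrite gt_eqF.
    by apply: ler_wpM2l; [rewrite divr_ge0 //; lra | apply: ler_wpM2l => //; lra].
  have e0 : 0 <= 2 / m * (D * Q).
    by apply: mulr_ge0; [rewrite divr_ge0 //; lra | apply: mulr_ge0 => //; lra].
  have e2 : 2 / m * (D * Q) <= 2 * D ^+ 3 / m ^+ 3 * T * (1 + l) by nra.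
  rewrite mulrDl; nra.
have k5 : 2 / u - 2 / m <= clock_slack s.+1 - clock_slack s + 2 * D ^+ 3 / m ^+ 3 * T.
  by move: k4; rewrite ler_pM2r //; lra.
have T0 : 0 <= 2 * D ^+ 3 / m ^+ 3 * T.
  rewrite mulr_ge0 ?sumr_ge0 // => [|i _]; last exact: sqr_ge0.
  by rewrite divr_ge0 ?mulr_ge0 ?exprn_ge0 //; lra.
rewrite /excess ge_max addr_ge0 ?excess_ge0 //=.
rewrite min_clockS -/l -/m.
apply: (@le_trans _ _ ((x - l - clock_slack s) + 2 * D ^+ 3 / m ^+ 3 * T)); first by lra.
by rewrite lerD2r le_max lexx orbT.
Qed.

Definition excess_const : R := 2 * d%:R ^+ 3 * \sum_(i < d.-1) imbalance_const R d i.+1.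

Lemma excess_const_ge0 : 0 <= excess_const.
Proof.
by rewrite mulr_ge0 ?sumr_ge0 // => i _; exact: imbalance_const_ge0.
Qed.

(** The expected squares are O(m), so the increments are O(1/m^2); summed over the
steps with deficit at least m they give O(1/m). *)
Lemma expect_excess s B : (2 * d * d <= deficit_after d n s)%N ->
  d%:R + 1 + d%:R * min_clock R d n s <= B ->
  expect d s (fun x (G : graph n) => excess s x) <= excess_const * B ^+ 2 / (deficit_after d n s)%:R.
Proof.
elim: s => [|s IHs] big sB.
  rewrite /expect /= /excess min_clock0 !sub0r max_l.
    apply: divr_ge0 => //; apply: mulr_ge0; last exact: sqr_ge0.
    exact: excess_const_ge0.
  by rewrite oppr0 add0r oppr_le0 /clock_slack mulr_ge0 ?sqrtr_ge0 // mulr_ge0.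
have big' : (2 * d * d <= deficit_after d n s)%N.
  by apply: leq_trans big _; rewrite /deficit_after; lia.
have sB' : d%:R + 1 + d%:R * min_clock R d n s <= B.
  by apply: le_trans sB; rewrite lerD2l ler_wpM2l // min_clock_mono.
have {IHs} Hs := IHs big' sB'.
have m8 := deficit_after_ge8 R d_ge2 big'.
have Hi (i : 'I_d.-1) : expect d s (fun x (G : graph n) => imbalance i.+1 x G ^+ 2)
    <= imbalance_const R d i.+1 * B ^+ 2 * (deficit_after d n s)%:R.
  by apply: expect_imbalance_sq => //; have := ltn_ord i; lia.
rewrite deficit_afterS //.
set m : R := (deficit_after d n s)%:R in m8 Hs Hi *.
apply: (@le_trans _ _ (expect d s (fun x (G : graph n) => excess s x + 2 * d%:R ^+ 3 / m ^+ 3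
     * \sum_(i < d.-1) imbalance i.+1 x G ^+ 2))).
  apply: expect_step => // x G Gr.
  have E := deficit_reachable d_ge2 Gr; have [Gwf _ _] := Gr.
  have Gbig : (2 * d * d <= deficit d G)%N by rewrite E.
  rewrite (advanceE d_ge2) // avg_cst; first exact: excess_advance.
  exact: (available_neq0 R d_ge2 Gwf Gbig).
rewrite expectD expectZ expect_sum.
have c0 : 0 <= 2 * d%:R ^+ 3 / m ^+ 3.
  by rewrite divr_ge0 ?mulr_ge0 ?exprn_ge0 //; lra.
apply: (le_trans (lerD Hs (ler_wpM2l c0 (ler_sum _ (fun i _ => Hi i))))).
rewrite -!mulr_suml.
have -> : 2 * d%:R ^+ 3 / m ^+ 3 * ((\sum_(i < d.-1) imbalance_const R d i.+1) * B ^+ 2 * m)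
   = excess_const * B ^+ 2 / m ^+ 2.
  by rewrite /excess_const; field; rewrite gt_eqF //; lra.
have -> : excess_const * B ^+ 2 / m + excess_const * B ^+ 2 / m ^+ 2
  = excess_const * B ^+ 2 * (m^-1 + m^-2) by ring.
apply: ler_wpM2l; first by apply: mulr_ge0; [exact: excess_const_ge0 | exact: sqr_ge0].
have -> : m^-1 + m^-2 = (m + 1) / m ^+ 2 by field; rewrite gt_eqF //; lra.
rewrite ler_pdivrMr; last by rewrite exprn_gt0 //; lra.
rewrite mulrC ler_pdivlMr; last lra.
nra.
Qed.

End ClockExcess.

(** * Decay of products of degree weights *)

Section Weights.
Variables (R : realType) (d n : nat).
Hypothesis d_ge2 : (2 <= d)%N.
Implicit Types (G : graph n) (v : 'I_n) (e B : {set 'I_n}).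

Definition degweight B (th : 'I_n -> nat -> R) G : R := \prod_(v in B) th v (deg G v).

Lemma bernoulli (y : R) k : 0 <= y <= 1 -> 1 - k%:R * y <= (1 - y) ^+ k.
Proof.
move=> /andP[y0 y1]; elim: k => [|k IH]; first by rewrite mul0r subr0 expr0.
rewrite exprSr -natr1; have k0 : 0 <= k%:R :> R by [].
apply: (@le_trans _ _ ((1 - k%:R * y) * (1 - y))); last by rewrite ler_wpM2r // subr_ge0.
have := mulr_ge0 k0 (mulr_ge0 y0 y0); nra.
Qed.

(** This bounds m^2 times the second-order terms in the chance that some vertex of a
[K]-set is hit: the errors in the single hitting probabilities and the pairs that
lie inside the set. *)
Definition second_order (K : nat) : R := d%:R ^+ 2 * (4 * d%:R * K%:R + 4 * 2 ^+ K).

Lemma second_order_ge0 K : 0 <= second_order K.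
Proof. by rewrite mulr_ge0 ?exprn_ge0 ?addr_ge0 ?mulr_ge0 ?exprn_ge0. Qed.

Lemma invr_deficit_afterS s : (2 * d * d <= deficit_after d n s.+1)%N ->
  ((deficit_after d n s)%:R ^+ 2)^-1 <= (deficit_after d n s.+1)%:R^-1 - (deficit_after d n s)%:R^-1 :> R.
Proof.
move=> big; have big' : (2 * d * d <= deficit_after d n s)%N.
  by apply: leq_trans big _; rewrite /deficit_after; lia.
have := deficit_after_ge8 R d_ge2 big; rewrite deficit_afterS //.
set m : R := (deficit_after d n s)%:R => m8.
have -> : (m - 2)^-1 - m^-1 = 2 / (m * (m - 2)).
  by field; rewrite !gt_eqF //; lra.
rewrite ler_pdivlMr; last by rewrite mulr_gt0; lra.
rewrite mulrC ler_pdivrMr; last by rewrite exprn_gt0; lra.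
nra.
Qed.

(** This turns an additive error into a factor that is an exponential, so that the
errors of successive steps add up in the exponent. *)
Lemma ratio_exp (q e0 C : R) : 0 < q -> q^-1 <= C -> 0 <= e0 -> q + e0 <= q * expR (C * e0).
Proof.
move=> q0 qC e00; apply: (@le_trans _ _ (q * (1 + C * e0))).
  rewrite mulrDr mulr1 lerD2l.
  have : 1 <= q * C by rewrite -(@mulfV _ q) ?gt_eqF // ler_pM2l.
  move=> /(ler_wpM2r e00); lra.
by rewrite ler_pM2l // expR_ge1Dx.
Qed.

Section Family.
Variables (B : {set 'I_n}) (th : 'I_n -> nat -> R) (r : R).
Hypothesis r01 : 0 <= r <= 1.
Hypothesis th_ge0 : forall v i, v \in B -> 0 <= th v i.
Hypothesis th_decr : forall v i, v \in B -> th v i.+1 <= r * th v i.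
Hypothesis th_sat : forall v, v \in B -> th v d = 0.

Lemma degweight_ge0 G : 0 <= degweight B th G.
Proof. by apply: prodr_ge0 => v /th_ge0. Qed.

(** One hit multiplies the product by at most [r].  Inclusion and exclusion is exact
here because an edge meets [B] in at most two vertices, and in two only if it is
contained in [B]. *)
Lemma degweight_add G e : e \in available d G ->
  degweight B th (e |: G)%SET <= degweight B th G
    * (1 - (1 - r) * (#|B :&: e|%SET%:R - (e \subset B)%:R)).
Proof.
case/availableP=> e2 eG _; have [r0 r1] := andP r01.
apply: (@le_trans _ _ (\prod_(v in B) (th v (deg G v) * (if v \in e then r else 1)))).
  apply: ler_prod => v vB; rewrite th_ge0 //= deg_add //.
  by case: ifP => _; rewrite ?addn1 ?addn0 ?mulr1 // mulrC th_decr.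
rewrite big_split /= ler_wpM2l ?degweight_ge0 // -big_mkcondr /=.
rewrite (eq_bigl (mem (B :&: e)%SET)) => [|v]; last by rewrite !inE.
rewrite prodr_const.
have le2 : (#|B :&: e| <= 2)%N by rewrite -e2 subset_leq_card // finset.subsetIr.
have sub : (e \subset B) = (#|B :&: e|%SET == 2%N).
  apply/idP/eqP => [/finset.setIidPr -> //|c2].
  by apply/finset.setIidPr/eqP; rewrite eqEcard finset.subsetIr c2 e2.
rewrite sub; case: #|_| le2 => [|[|[|//]]] _ /=.
- by rewrite expr0 mulr0n; lra.
- by rewrite expr1 mulr0n; lra.
- by rewrite mulr1n; nra.
Qed.

(** If the product is not zero, all vertices of [B] are unsaturated, so each of them is
hit with probability about 2/u, which is at least 2/m up to second order. *)
Lemma degweight_advance s (x : R) G : reachable d s x G -> (2 * d * d <= deficit_after d n s)%N ->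
  advance d (fun _ => degweight B th) x G <= degweight B th G *
   (1 - #|B|%:R * (2 / (deficit_after d n s)%:R) + #|B|%:R * r * (2 / (deficit_after d n s)%:R)
      + second_order #|B| / (deficit_after d n s)%:R ^+ 2).
Proof.
move=> Gr big; have E := deficit_reachable d_ge2 Gr; have [Gwf _ _] := Gr.
have Gbig : (2 * d * d <= deficit d G)%N by rewrite E.
have A0 := available_neq0 R d_ge2 Gwf Gbig.
have [r0 r1] := andP r01.
rewrite (advanceE d_ge2) //.
pose g e := degweight B th G * (1 - (1 - r) * (#|B :&: e|%SET%:R - (e \subset B)%:R)).
apply: (@le_trans _ _ (avg (available d G) g)).
  by apply: avg_le => e eA; exact: degweight_add.
rewrite /g avgZ.
case: (eqVneq (degweight B th G) 0) => [->|nz]; first by rewrite !mul0r.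
apply: ler_wpM2l; first exact: degweight_ge0.
have BU v : v \in B -> v \in unsat d G.
  move=> vB; rewrite in_unsat ltnNge; apply/negP => dv.
  have degv : deg G v = d by apply/eqP; rewrite eqn_leq dv Gwf.2.
  by case/eqP: nz; rewrite /degweight (bigD1 v) //= degv th_sat // mul0r.
pose sub : R := avg (available d G) (fun e => (e \subset B)%:R).
have -> : avg (available d G)
    (fun e => 1 - (1 - r) * (#|B :&: e|%SET%:R - (e \subset B)%:R))
    = 1 - (1 - r) * (\sum_(v in B) pick_prob R d G v - sub).
  rewrite (eq_avg (g := fun e => 1 + (- (1 - r)) *
    (\sum_(v in B) (v \in e)%:R + (-1) * (e \subset B)%:R))).
    by rewrite avgD avg_cst // avgZ avgD avgZ avg_sum mulN1r mulNr.
  move=> e _; rewrite mulN1r mulNr; do 4 f_equal.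
  rewrite -sum1_card natr_sum big_mkcond [RHS]big_mkcond /=; apply: eq_bigr => v _.
  by rewrite inE; case: (v \in B); case: (v \in e).
have u4 := unsat_ge4 R d_ge2 Gbig.
have um := unsat_le_deficit R d G; rewrite E in um.
have mu := deficit_le_unsatR R d G; rewrite E in mu.
have ua := available_lower_sq R d_ge2 Gwf Gbig.
set u : R := #|unsat d G|%:R in u4 um mu ua *.
set m : R := (deficit_after d n s)%:R in um mu *.
set a : R := #|available d G|%:R in ua *.
have u0 : 0 < u by apply: lt_le_trans u4.
have m0 : 0 < m by apply: lt_le_trans um.
have a0 : 0 < a by nra.
have subB : sub <= 4 * 2 ^+ #|B| / u ^+ 2.
  apply: (@le_trans _ _ (2 ^+ #|B| / a)).
    rewrite /sub /avg ler_wpM2r ?invr_ge0 //.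
    apply: (@le_trans _ _ (\sum_(e in powerset B) 1)).
      rewrite big_mkcond [leRHS]big_mkcond; apply: ler_sum => e _ /=.
      by rewrite powersetE; case: (e \in _); case: (e \subset B).
    by rewrite sumr_const card_powerset natrX.
  by rewrite ler_pdivlMr ?exprn_gt0 // mulrAC ler_pdivrMr // -[leRHS]mulrA [leRHS]mulrCA ler_wpM2l //.
have pB : #|B|%:R * (2 / u - 4 * d%:R / u ^+ 2) <= \sum_(v in B) pick_prob R d G v.
  rewrite mulr_natl -sumr_const; apply: ler_sum => v /BU vU.
  have := pick_prob_unsat R d_ge2 Gwf Gbig vU; rewrite -/u ler_norml => /andP[+ _].
  by rewrite lerBrDl addrC -lerBrDl opprK addrC.
have K0 : 0 <= #|B|%:R :> R by [].
set K : R := #|B|%:R in K0 pB *.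
set P : R := \sum_(v in B) _ in pB *.
have iu : m^-1 <= u^-1 by rewrite lef_pV2.
have iu2 : u^-2 <= d%:R ^+ 2 / m ^+ 2.
  rewrite ler_pdivlMr ?exprn_gt0 // mulrC ler_pdivrMr ?exprn_gt0 //.
  by rewrite -exprMn ler_sqr ?nnegrE ?mulr_ge0 // ltW.
have iu2' : 0 <= u^-2 by rewrite invr_ge0 exprn_ge0 // ltW.
set so := 4 * d%:R * K + 4 * 2 ^+ #|B|.
have so0 : 0 <= so by rewrite addr_ge0 ?mulr_ge0 ?exprn_ge0.
have h1 : K * (2 / m) - so * (d%:R ^+ 2 / m ^+ 2) <= P - sub + (K * (2 / u) - K * (2 / u)).
  have k1 : K * (2 / m) <= K * (2 / u) by rewrite ler_wpM2l // ler_wpM2l.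
  have k2 : so * u^-2 <= so * (d%:R ^+ 2 / m ^+ 2) by rewrite ler_wpM2l.
  have k3 : so * u^-2 = K * (4 * d%:R / u ^+ 2) + 4 * 2 ^+ #|B| / u ^+ 2 by rewrite /so; ring.
  have k4 : K * (2 / u - 4 * d%:R / u ^+ 2) = K * (2 / u) - K * (4 * d%:R / u ^+ 2) by ring.
  lra.
rewrite subrr addr0 in h1.
have h2 : 0 <= so * (d%:R ^+ 2 / m ^+ 2).
  by rewrite mulr_ge0 // divr_ge0 ?exprn_ge0 // ltW.
have -> : second_order #|B| / m ^+ 2 = so * (d%:R ^+ 2 / m ^+ 2).
  by rewrite /second_order /so -/K; ring.
have h3 : (1 - r) * (K * (2 / m) - so * (d%:R ^+ 2 / m ^+ 2)) <= (1 - r) * (P - sub).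
  by apply: ler_wpM2l => //; lra.
have h4 : 0 <= r * (so * (d%:R ^+ 2 / m ^+ 2)) by rewrite mulr_ge0.
nra.
Qed.

(** The accumulated relative deviation of the expected weight from the exact decay
m^[K]: the first summand comes from the fraction [r] that is left after a hit, the
second from the second-order terms. *)
Definition growth (K : nat) (s0 s1 : nat) : R :=
  2 ^+ K * (K%:R * r * (min_clock R d n s1 - min_clock R d n s0)
            + second_order K / (deficit_after d n s1)%:R).

Lemma expect_degweight_le s0 s1 : (s0 <= s1)%N -> (2 * d * d <= deficit_after d n s1)%N ->
  expect d s1 (fun _ => degweight B th) <=
   ((deficit_after d n s1)%:R / (deficit_after d n s0)%:R) ^+ #|B| * expR (growth #|B| s0 s1)
   * expect d s0 (fun _ => degweight B th).
Proof.
have [r0 r1] := andP r01.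
elim: s1 => [|s1 IH].
  rewrite leqn0 => /eqP -> big; rewrite divff ?expr1n ?mul1r; last first.
    by rewrite gt_eqF //; have := deficit_after_ge8 R d_ge2 big; lra.
  apply: ler_peMl; first exact: degweight_ge0.
  rewrite -expR0 ler_expR /growth subrr mulr0 add0r.
  by rewrite mulr_ge0 ?exprn_ge0 ?divr_ge0 ?second_order_ge0.
rewrite leq_eqVlt => /orP[/eqP <-|] big.
  rewrite divff ?expr1n ?mul1r; last first.
    by rewrite gt_eqF //; have := deficit_after_ge8 R d_ge2 big; lra.
  apply: ler_peMl.
    rewrite -(expect_cst d n s0 0); apply: expect_le => // x G _; exact: degweight_ge0.
  rewrite -expR0 ler_expR /growth subrr mulr0 add0r.
  by rewrite mulr_ge0 ?exprn_ge0 ?divr_ge0 ?second_order_ge0.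
rewrite ltnS in big => big1.
have big' : (2 * d * d <= deficit_after d n s1)%N.
  by apply: leq_trans big1 _; rewrite /deficit_after; lia.
have big0 : (2 * d * d <= deficit_after d n s0)%N.
  by apply: leq_trans big' _; rewrite leq_sub2l // leq_pmul2l.
have {IH} IH := IH big big'.
have m8 := deficit_after_ge8 R d_ge2 big'.
have inv := invr_deficit_afterS big1.
have rS := deficit_afterS R d_ge2 big'.
set K := #|B| in IH *.
set m : R := (deficit_after d n s1)%:R in IH m8 inv rS.
set m' : R := (deficit_after d n s1.+1)%:R in inv rS *.
set m0 : R := (deficit_after d n s0)%:R in IH *.
have mp : 0 < m by lra.
have m'p : 0 < m' by lra.
have m0p : 0 < m0.
  by have := deficit_after_ge8 R d_ge2 big0; rewrite -/m0; lra.
set e0 := K%:R * r * (2 / m) + second_order K / m ^+ 2.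
have e00 : 0 <= e0.
  apply: addr_ge0; last by rewrite divr_ge0 ?second_order_ge0 ?exprn_ge0.
  by apply: mulr_ge0; [exact: mulr_ge0 | rewrite divr_ge0 // ltW].
apply: (@le_trans _ _ (expect d s1 (fun _ G => (1 - K%:R * (2 / m) + e0) * degweight B th G))).
  apply: expect_step => // x G Gr; rewrite mulrC addrA; exact: degweight_advance.
rewrite expectZ.
set q := (m' / m) ^+ K.
have mm : m' / m = 1 - 2 / m by rewrite rS; field; rewrite gt_eqF.
have q0 : 0 < q by rewrite exprn_gt0 // divr_gt0.
have q1 : 1 - K%:R * (2 / m) <= q.
  rewrite /q mm; apply: bernoulli; apply/andP; split; first by rewrite divr_ge0 //; lra.
  by rewrite ler_pdivrMr //; lra.
have q2 : q^-1 <= 2 ^+ K.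
  rewrite /q -exprVn lerXn2r ?nnegrE ?invr_ge0 ?divr_ge0 //; try lra.
  by rewrite invf_div ler_pdivrMr //; lra.
have Eg : growth K s0 s1 + 2 ^+ K * e0 <= growth K s0 s1.+1.
  rewrite /growth -mulrDr ler_wpM2l ?exprn_ge0 // /e0 min_clockS -/m -/m'.
  have := ler_wpM2l (second_order_ge0 K) inv; nra.
have EX0 : 0 <= expect d s1 (fun=> degweight B th).
  by rewrite -(expect_cst d n s1 0); apply: expect_le => // x G _; exact: degweight_ge0.
have := ratio_exp q0 q2 e00; set ex := expR _ => rx.
apply: (@le_trans _ _ (q * ex * expect d s1 (fun=> degweight B th))).
  by apply: ler_wpM2r => //; lra.
apply: (@le_trans _ _ (q * ex * ((m / m0) ^+ K * expR (growth K s0 s1)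
   * expect d s0 (fun=> degweight B th)))).
  by apply: ler_wpM2l => //; rewrite mulr_ge0 ?expR_ge0 // ltW.
have -> : q * ex * ((m / m0) ^+ K * expR (growth K s0 s1) * expect d s0 (fun=> degweight B th))
  = (q * (m / m0) ^+ K) * (expR (growth K s0 s1) * ex) * expect d s0 (fun=> degweight B th).
  by ring.
have -> : q * (m / m0) ^+ K = (m' / m0) ^+ K.
  by rewrite /q -exprMn mulrA divfK // gt_eqF.
apply: ler_wpM2r.
  rewrite -(expect_cst d n s0 0); apply: (expect_le d_ge2) => [|x G _]; last exact: degweight_ge0.
  exact: big0.
apply: ler_wpM2l; first by rewrite exprn_ge0 // divr_ge0 // ltW.
by rewrite /ex -expRD ler_expR.
Qed.

End Family.
End Weights.

(** * Tuples of vertices *)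

Section Tuples.
Variables (R : realType) (d n : nat).
Hypothesis d_ge2 : (2 <= d)%N.
Implicit Types (G : graph n) (v : 'I_n) (e B : {set 'I_n}).

Definition exact_weight (j i : nat) : R := (i == j)%:R.

(** A vertex of degree below [j] can still reach degree [j]; its weight is larger
for every hit that it needs, so that each of these hits multiplies it by [r]. *)
Definition geom_weight (r : R) (j i : nat) : R := if (i <= j)%N then r^-1 ^+ (j - i) else 0.

Definition weighted_count (w : nat -> R) G : R := \sum_v w (deg G v).

Lemma geom_weight_ge0 r j i : 0 <= r -> 0 <= geom_weight r j i.
Proof. by move=> r0; rewrite /geom_weight; case: ifP => // _; rewrite exprn_ge0 // invr_ge0. Qed.

Lemma geom_weight_decr r j i : 0 < r -> geom_weight r j i.+1 <= r * geom_weight r j i.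
Proof.
move=> r0; rewrite /geom_weight; case: (ltngtP i j) => ij.
- have -> : (j - i = (j - i.+1).+1)%N by rewrite -subSn // subSS.
  by rewrite exprS mulrA divff ?mul1r // gt_eqF.
- by rewrite mulr0.
- by rewrite mulr_ge0 ?exprn_ge0 ?invr_ge0 ?ltW.
Qed.

Lemma geom_weight_sat r j : (j < d)%N -> geom_weight r j d = 0.
Proof. by move=> jd; rewrite /geom_weight leqNgt jd. Qed.

Lemma exact_weight_le_geom r j i : 0 < r -> exact_weight j i <= geom_weight r j i.
Proof.
move=> r0; rewrite /exact_weight; case: eqP => [->|_]; last exact/geom_weight_ge0/ltW.
by rewrite /geom_weight leqnn subnn expr0.
Qed.

Lemma low_le_geom_weight r i : 0 < r <= 1 -> (i.+1 < d)%:R <= geom_weight r (d - 2) i.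
Proof.
move=> /andP[r0 r1]; case: ltnP => id; last exact/geom_weight_ge0/ltW.
have id' : (i <= d - 2)%N by lia.
by rewrite /geom_weight id' exprn_ege1 // invf_ge1.
Qed.

(** A set of vertices of degree [j] stays one unless some of its vertices are hit.  Up
to second order, only the vertices of low degree make the chance of a hit exceed
2/m per vertex. *)
Lemma exact_advance s (x : R) G B j : reachable d s x G -> (2 * d * d <= deficit_after d n s)%N ->
  degweight B (fun _ => exact_weight j) G * (1 - #|B|%:R * (2 / (deficit_after d n s)%:R)
     - #|B|%:R * (4 * d%:R ^+ 3 + 2 * d%:R ^+ 2 * low R d G) / (deficit_after d n s)%:R ^+ 2)
  <= advance d (fun _ => degweight B (fun _ => exact_weight j)) x G.
Proof.
move=> Gr big; have E := deficit_reachable d_ge2 Gr; have [Gwf _ _] := Gr.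
have Gbig : (2 * d * d <= deficit d G)%N by rewrite E.
have A0 := available_neq0 R d_ge2 Gwf Gbig.
have Y0 H : 0 <= degweight B (fun _ => exact_weight j) H.
  by apply: degweight_ge0 => v i _; rewrite /exact_weight ler0n.
rewrite (advanceE d_ge2) //.
pose g e := degweight B (fun _ => exact_weight j) G * (1 - \sum_(v in B) (v \in e)%:R).
apply: (@le_trans _ _ (avg (available d G) g)); last first.
  apply: avg_le => e /availableP[_ eG _]; rewrite /g.
  case: (boolP [exists v in B, v \in e]) => [/'exists_andP[v [vB ve]]|].
    apply: (@le_trans _ _ 0) => //; apply: mulr_ge0_le0 => //.
    by rewrite subr_le0 (bigD1 v) //= ve lerDl sumr_ge0.
  move=> /'exists_andP nB; have nBe v : v \in B -> v \in e = false.
    by move=> vB; apply/negP => ve; apply: nB; exists v.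
  rewrite big1 => [|v /nBe -> //]; rewrite subr0 mulr1 le_eqVlt; apply/orP; left.
  by apply/eqP/eq_bigr => v /nBe ve; rewrite deg_add // ve addn0.
rewrite /g avgZ; apply: ler_wpM2l => //.
have -> : avg (available d G) (fun e : {set 'I_n} => 1 - \sum_(v in B) (v \in e)%:R)
   = 1 - \sum_(v in B) pick_prob R d G v.
  rewrite -avg_sum -mulN1r -avgZ -[X in X + _](avg_cst 1 A0) -avgD.
  by apply: eq_avg => e _; rewrite mulN1r.
have u4 := unsat_ge4 R d_ge2 Gbig.
have um := unsat_le_deficit R d G; rewrite E in um.
have mu := deficit_le_unsatR R d G; rewrite E in mu.
have dl := deficit_sub_unsat_le R d_ge2 G; rewrite E in dl.
have lG := low_ge0 R d G.
set u : R := #|unsat d G|%:R in u4 um mu dl *.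
set m : R := (deficit_after d n s)%:R in um mu dl *.
have u0 : 0 < u by apply: lt_le_trans u4.
have m0 : 0 < m by apply: lt_le_trans um.
have pB : \sum_(v in B) pick_prob R d G v <= #|B|%:R * (2 / u + 4 * d%:R / u ^+ 2).
  rewrite mulr_natl -sumr_const; apply: ler_sum => v _.
  have [vU|vU] := boolP (v \in unsat d G); last first.
    by rewrite pick_prob_sat // addr_ge0 ?divr_ge0 ?mulr_ge0 ?exprn_ge0 // ltW.
  have := pick_prob_unsat R d_ge2 Gwf Gbig vU; rewrite -/u ler_norml => /andP[_].
  by rewrite lerBlDl.
have K0 : 0 <= #|B|%:R :> R by [].
set K : R := #|B|%:R in K0 pB *.
have iu : u^-1 <= d%:R / m.
  by rewrite ler_pdivlMr // mulrC ler_pdivrMr.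
have iu0 : 0 < u^-1 by rewrite invr_gt0.
have im0 : 0 < m^-1 by rewrite invr_gt0.
have iu2 : u^-2 <= d%:R ^+ 2 / m ^+ 2.
  by rewrite -!exprVn -exprMn ler_sqr ?nnegrE ?mulr_ge0 // ltW.
have h1 : 2 / u - 2 / m <= 2 * d%:R ^+ 2 * low R d G / m ^+ 2.
  have -> : 2 / u - 2 / m = 2 * (m - u) / m / u by field; rewrite !gt_eqF.
  have -> : 2 * d%:R ^+ 2 * low R d G / m ^+ 2
     = 2 * (d%:R * low R d G) / m * (d%:R / m) by field; rewrite gt_eqF.
  apply: ler_pM => //; first by rewrite divr_ge0 ?mulr_ge0 ?subr_ge0 // ltW.
    exact: ltW.
  by rewrite ler_pM2r // ler_pM2l.
have h2 : 4 * d%:R / u ^+ 2 <= 4 * d%:R ^+ 3 / m ^+ 2.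
  have -> : 4 * d%:R ^+ 3 / m ^+ 2 = 4 * d%:R * (d%:R ^+ 2 / m ^+ 2) by ring.
  by apply: ler_wpM2l => //; rewrite mulr_ge0.
have h3 : K * (2 / u + 4 * d%:R / u ^+ 2) <=
  K * (2 / m + 2 * d%:R ^+ 2 * low R d G / m ^+ 2 + 4 * d%:R ^+ 3 / m ^+ 2).
  by apply: ler_wpM2l => //; lra.
have -> : K * (4 * d%:R ^+ 3 + 2 * d%:R ^+ 2 * low R d G) / m ^+ 2 =
  K * (2 * d%:R ^+ 2 * low R d G / m ^+ 2) + K * (4 * d%:R ^+ 3 / m ^+ 2) by ring.
move: h3; rewrite !mulrDr; lra.
Qed.

Section Fixed.
Variables (j k : nat).
Hypothesis jd : (j < d)%N.

Definition vertices (f : {ffun 'I_k -> 'I_n}) : {set 'I_n} := f @: 'I_k.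

Lemma card_vertices (f : {ffun 'I_k -> 'I_n}) : injectiveb f -> #|vertices f| = k.
Proof. by move=> /injectiveP fi; rewrite card_imset // card_ord. Qed.

Lemma degweight_vertices (f : {ffun 'I_k -> 'I_n}) (w : nat -> R) G : injectiveb f ->
  degweight (vertices f) (fun _ => w) G = \prod_l w (deg G (f l)).
Proof.
by move=> /injectiveP fi; rewrite /degweight big_imset //= => a b _ _ /fi.
Qed.

(** Falling factorials count injective tuples. *)
Lemma num_deg_ffact G : (num_deg j G ^_ k)%:R
  = \sum_(f : {ffun 'I_k -> 'I_n} | injectiveb f) degweight (vertices f) (fun _ => exact_weight j) G.
Proof.
pose D := [set v | deg G v == j]%SET.
have := card_inj_ffuns_on 'I_k (mem D).
rewrite card_ord -/(num_deg j G) /num_deg => <-.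
rewrite -sum1_card natr_sum big_mkcond [RHS]big_mkcond /=; apply: eq_bigr => f _.
rewrite !inE andbC; case: ifP => [/andP[fi fD]|]; case: (boolP (injectiveb f)) => //.
- move=> _; rewrite degweight_vertices // big1 // => l _.
  by have /ffun_onP/(_ l) := fD; rewrite !inE /exact_weight => ->.
- by move=> /negP; rewrite fi.
move=> fi /= /negbT/ffun_onP nD; rewrite degweight_vertices //.
have [l nl] : exists l, ~~ (deg G (f l) == j).
  apply/existsP; rewrite -negb_forall; apply/negP => /forallP al; apply: nD => l.
  by rewrite !inE; apply: al.
by rewrite (bigD1 l) //= /exact_weight (negbTE nl) mul0r.
Qed.

Lemma sum_prod_weights_le (w : nat -> R) G : (forall i, 0 <= w i) ->
  \sum_(f : {ffun 'I_k -> 'I_n} | injectiveb f) degweight (vertices f) (fun _ => w) G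
  <= weighted_count w G ^+ k.
Proof.
move=> w0; rewrite /weighted_count -[X in _ ^+ X]card_ord -prodr_const.
rewrite bigA_distr_bigA /= big_mkcond /=; apply: ler_sum => f _.
by case: ifP => fi; rewrite ?degweight_vertices ?prodr_ge0.
Qed.

End Fixed.
End Tuples.

(** * Factorial moments in the final phase *)

Section Moments.
Variables (R : realType) (d n : nat).
Hypothesis d_ge2 : (2 <= d)%N.
Variables (j k : nat) (r : R).
Hypothesis jd : (j < d)%N.
Hypothesis r01 : 0 < r <= 1.
Implicit Types (G : graph n) (v : 'I_n) (e B : {set 'I_n}).

Let r0 : 0 < r. Proof. by case/andP: r01. Qed.
Let r1 : r <= 1. Proof. by case/andP: r01. Qed.
Let r01' : 0 <= r <= 1. Proof. by rewrite ltW. Qed.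

Definition ffact_deg G : R := (num_deg j G ^_ k)%:R.

Lemma deficit_after_big_mono s s' : (s <= s')%N -> (2 * d * d <= deficit_after d n s')%N ->
  (2 * d * d <= deficit_after d n s)%N.
Proof. by move=> ss big; apply: leq_trans big _; rewrite leq_sub2l // leq_pmul2l. Qed.

Lemma expect_ffact_upper s0 s1 : (s0 <= s1)%N -> (2 * d * d <= deficit_after d n s1)%N ->
  expect d s1 (fun _ => ffact_deg) <=
  ((deficit_after d n s1)%:R / (deficit_after d n s0)%:R) ^+ k * expR (growth d n r k s0 s1)
  * expect d s0 (fun _ G => weighted_count (geom_weight r j) G ^+ k).
Proof.
move=> s01 big.
have big0 := deficit_after_big_mono s01 big.
apply: (@le_trans _ _ (expect d s1 (fun _ G =>
   \sum_(f : {ffun 'I_k -> 'I_n} | injectiveb f) degweight (vertices f) (fun _ => geom_weight r j) G))).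
  apply: expect_le => // x G _; rewrite /ffact_deg num_deg_ffact.
  apply: ler_sum => f fi; rewrite !degweight_vertices //; apply: ler_prod => l _.
  by rewrite exact_weight_le_geom // andbT ler0n.
rewrite expect_sum.
apply: (@le_trans _ _ (\sum_(f : {ffun 'I_k -> 'I_n} | injectiveb f)
  ((deficit_after d n s1)%:R / (deficit_after d n s0)%:R) ^+ k * expR (growth d n r k s0 s1)
   * expect d s0 (fun _ => degweight (vertices f) (fun _ => geom_weight r j)))).
  apply: ler_sum => f fi.
  have g0 v i : v \in vertices f -> 0 <= geom_weight r j i by move=> _; exact/geom_weight_ge0/ltW.
  have gd v i : v \in vertices f -> geom_weight r j i.+1 <= r * geom_weight r j i.
    by move=> _; exact: geom_weight_decr.
  have gs v : v \in vertices f -> geom_weight r j d = 0 by move=> _; exact: geom_weight_sat.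
  by have := expect_degweight_le d_ge2 r01' g0 gd gs s01 big; rewrite card_vertices.
rewrite -mulr_sumr -expect_sum; apply: ler_wpM2l.
  by rewrite mulr_ge0 ?expR_ge0 // exprn_ge0 // divr_ge0.
apply: expect_le => // x G _; apply: sum_prod_weights_le => i.
exact/geom_weight_ge0/ltW.
Qed.

Let mixw v (w : 'I_n) : nat -> R := if w == v then geom_weight r (d - 2) else geom_weight r j.

(** The low vertex is either one of the [k] chosen ones or a further vertex, and in the
second case the [k.+1] vertices have a product of weights of the decaying kind. *)
Lemma ffact_low_le G : ffact_deg G * low R d G <= k%:R * ffact_deg G +
  \sum_(f : {ffun 'I_k -> 'I_n} | injectiveb f)
    \sum_(v | v \notin vertices f) degweight (v |: vertices f)%SET (mixw v) G.
Proof.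
rewrite /ffact_deg num_deg_ffact // mulr_suml mulr_sumr -big_split /=.
apply: ler_sum => f fi.
have Y0 : 0 <= degweight (vertices f) (fun _ => exact_weight R j) G.
  by apply: degweight_ge0 => v i _; rewrite /exact_weight ler0n.
rewrite /low (bigID (mem (vertices f))) /= mulrDr; apply: lerD.
  rewrite mulrC; apply: ler_wpM2r => //.
  apply: (@le_trans _ _ (\sum_(v in vertices f) 1)); last by rewrite sumr_const card_vertices.
  by apply: ler_sum => v _; case: (_ < _)%N.
rewrite mulr_sumr; apply: ler_sum => v vf.
rewrite /degweight big_setU1 //= mulrC; apply: ler_pM => //.
  by rewrite /mixw eqxx low_le_geom_weight.
apply: ler_prod => w wf; rewrite /exact_weight ler0n /= /mixw.
case: (eqVneq w v) => [wv|_]; first by rewrite -wv wf in vf.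
exact: exact_weight_le_geom.
Qed.

Lemma sum_mixed_le G :
  \sum_(f : {ffun 'I_k -> 'I_n} | injectiveb f)
    \sum_(v | v \notin vertices f) degweight (v |: vertices f)%SET (mixw v) G
  <= weighted_count (geom_weight r j) G ^+ k * weighted_count (geom_weight r (d - 2)) G.
Proof.
have g0 i a : 0 <= geom_weight r i a by exact/geom_weight_ge0/ltW.
apply: (@le_trans _ _ (\sum_(f : {ffun 'I_k -> 'I_n} | injectiveb f)
   degweight (vertices f) (fun _ => geom_weight r j) G * weighted_count (geom_weight r (d - 2)) G)).
  apply: ler_sum => f fi; rewrite /weighted_count mulr_sumr big_mkcond /=.
  apply: ler_sum => v _; have D0 : 0 <= degweight (vertices f) (fun _ => geom_weight r j) G.
    exact: degweight_ge0.
  case: ifP => vf; last by rewrite mulr_ge0.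
  rewrite /degweight big_setU1 //= {1}/mixw eqxx mulrC; apply: ler_wpM2r => //.
  rewrite le_eqVlt; apply/orP; left; apply/eqP/eq_bigr => w wf.
  by rewrite /mixw; case: (eqVneq w v) => // wv; rewrite -wv wf in vf.
rewrite -mulr_suml; apply: ler_wpM2r; first by apply: sumr_ge0.
exact: sum_prod_weights_le.
Qed.

Lemma expect_ffact_low_le s0 s1 : (s0 <= s1)%N -> (2 * d * d <= deficit_after d n s1)%N ->
  expect d s1 (fun _ G => ffact_deg G * low R d G) <=
  k%:R * expect d s1 (fun _ => ffact_deg) +
  ((deficit_after d n s1)%:R / (deficit_after d n s0)%:R) ^+ k.+1 * expR (growth d n r k.+1 s0 s1)
  * expect d s0 (fun _ G => weighted_count (geom_weight r j) G ^+ k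
                             * weighted_count (geom_weight r (d - 2)) G).
Proof.
move=> s01 big.
have big0 := deficit_after_big_mono s01 big.
apply: le_trans (expect_le d_ge2 big (fun x G _ => ffact_low_le G)) _.
rewrite expectD expectZ lerD2l expect_sum.
under eq_bigr do rewrite expect_sum.
set c := _ * expR _.
apply: (@le_trans _ _ (\sum_(f : {ffun 'I_k -> 'I_n} | injectiveb f)
    \sum_(v | v \notin vertices f) c * expect d s0 (fun _ => degweight (v |: vertices f)%SET (mixw v)))).
  apply: ler_sum => f fi; apply: ler_sum => v vf; rewrite /c.
  have g0 w i : w \in (v |: vertices f)%SET -> 0 <= mixw v w i.
    by move=> _; rewrite /mixw; case: ifP => _; exact/geom_weight_ge0/ltW.
  have gd w i : w \in (v |: vertices f)%SET -> mixw v w i.+1 <= r * mixw v w i.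
    by move=> _; rewrite /mixw; case: ifP => _; exact: geom_weight_decr.
  have gs w : w \in (v |: vertices f)%SET -> mixw v w d = 0.
    move=> _; rewrite /mixw; case: ifP => _; apply: geom_weight_sat => //.
    by rewrite ltn_subrL /= (leq_trans _ d_ge2).
  by have := expect_degweight_le d_ge2 r01' g0 gd gs s01 big; rewrite cardsU1 vf card_vertices.
under eq_bigr do rewrite -mulr_sumr -expect_sum.
rewrite -mulr_sumr -expect_sum; apply: ler_wpM2l.
  by rewrite mulr_ge0 ?expR_ge0 // exprn_ge0 // divr_ge0.
by apply: expect_le => // x G _; exact: sum_mixed_le.
Qed.

Lemma ffact_advance s : (2 * d * d <= deficit_after d n s)%N ->
  (1 - k%:R * (2 / (deficit_after d n s)%:R) - k%:R * (4 * d%:R ^+ 3) / (deficit_after d n s)%:R ^+ 2)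
     * expect d s (fun _ => ffact_deg)
  - k%:R * (2 * d%:R ^+ 2) / (deficit_after d n s)%:R ^+ 2
     * expect d s (fun _ G => ffact_deg G * low R d G)
  <= expect d s.+1 (fun _ => ffact_deg).
Proof.
move=> big; rewrite -[X in _ + X <= _]mulNr -!expectZ -expectD.
rewrite [leRHS](_ : _ = expect d s.+1 (fun _ G =>
   \sum_(f : {ffun 'I_k -> 'I_n} | injectiveb f) degweight (vertices f) (fun _ => exact_weight R j) G)).
  2: by congr (expect _ _ _); apply/funext => x; apply/funext => G; rewrite -num_deg_ffact.
rewrite expect_sum.
under [leRHS]eq_bigr do rewrite expectS.
rewrite -expect_sum; apply: expect_le => // x G Gr.
rewrite /ffact_deg num_deg_ffact // mulr_suml !mulr_sumr -big_split /=.
apply: ler_sum => f fi; apply: le_trans (exact_advance d_ge2 _ _ Gr big).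
rewrite card_vertices // le_eqVlt; apply/orP; left; apply/eqP.
have := deficit_after_ge8 R d_ge2 big; set m : R := (deficit_after d n s)%:R => m8.
by field; rewrite gt_eqF //; lra.
Qed.

Lemma bernoulli2 (y : R) K : 0 <= y <= 1 ->
  (1 - y) ^+ K <= 1 - K%:R * y + K%:R ^+ 2 * y ^+ 2.
Proof.
move=> /andP[y0 y1]; elim: K => [|K IH]; first by rewrite expr0 !mul0r; lra.
rewrite exprSr -natr1; have K0 : 0 <= K%:R :> R by [].
set c : R := K%:R in K0 IH *.
apply: (@le_trans _ _ ((1 - c * y + c ^+ 2 * y ^+ 2) * (1 - y))).
  by rewrite ler_wpM2r // subr_ge0.
have h1 := mulr_ge0 (mulr_ge0 K0 y0) y0.
have h2 := mulr_ge0 (mulr_ge0 (mulr_ge0 K0 K0) (mulr_ge0 y0 y0)) y0.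
have h3 := mulr_ge0 y0 y0.
nra.
Qed.

Definition drift_const : R :=
  2 ^+ k * (4 * k%:R ^+ 2 + k%:R * (4 * d%:R ^+ 3) + k%:R ^+ 2 * (2 * d%:R ^+ 2)).

Lemma drift_const_ge0 : 0 <= drift_const.
Proof. by rewrite mulr_ge0 ?exprn_ge0 ?addr_ge0 ?mulr_ge0 ?exprn_ge0. Qed.

(** After division by m^[k] the loss in one step is at most a constant times
[M]/m^2 + [V]/m.  The first terms sum to O([M]/m), and the second ones sum to a
multiple of the time that passes on the minimal clock. *)
Lemma expect_ffact_lower s0 s1 (M V : R) : (s0 <= s1)%N -> (2 * d * d <= deficit_after d n s1)%N ->
  0 <= V ->
  (forall s, (s0 <= s <= s1)%N ->
     expect d s (fun _ => ffact_deg) <= M * (deficit_after d n s)%:R ^+ k) ->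
  (forall s, (s0 <= s <= s1)%N ->
     expect d s (fun _ G => ffact_deg G * low R d G) <=
      k%:R * expect d s (fun _ => ffact_deg) + V * (deficit_after d n s)%:R ^+ k.+1) ->
  expect d s0 (fun _ => ffact_deg) / (deficit_after d n s0)%:R ^+ k
   - drift_const * M / (deficit_after d n s1)%:R
   - 2 ^+ k * (k%:R * d%:R ^+ 2) * V * (min_clock R d n s1 - min_clock R d n s0)
  <= expect d s1 (fun _ => ffact_deg) / (deficit_after d n s1)%:R ^+ k.
Proof.
move=> + + V0; have ff0 s : (2 * d * d <= deficit_after d n s)%N ->
    0 <= expect d s (fun _ => ffact_deg).
  move=> big; rewrite -(expect_cst d n s 0); apply: (expect_le d_ge2 big) => x G _.
  exact: ler0n.
have base s : (2 * d * d <= deficit_after d n s)%N ->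
   (expect d s (fun _ => ffact_deg) <= M * (deficit_after d n s)%:R ^+ k) ->
  expect d s (fun _ => ffact_deg) / (deficit_after d n s)%:R ^+ k
   - drift_const * M / (deficit_after d n s)%:R
   - 2 ^+ k * (k%:R * d%:R ^+ 2) * V * (min_clock R d n s - min_clock R d n s)
  <= expect d s (fun _ => ffact_deg) / (deficit_after d n s)%:R ^+ k.
  move=> big sM; rewrite subrr mulr0 subr0 lerBlDr lerDl divr_ge0 //.
  apply: mulr_ge0; first exact: drift_const_ge0.
  have := le_trans (ff0 _ big) sM; rewrite pmulr_lge0 // exprn_gt0 //.
  by have := deficit_after_ge8 R d_ge2 big; lra.
elim: s1 => [|s1 IH].
  by rewrite leqn0 => /eqP -> big hM _; apply: base => //; apply: hM.
rewrite leq_eqVlt => /orP[/eqP <-|] big.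
  by move=> hM _; apply: base => //; apply: hM; rewrite leqnn.
rewrite ltnS in big => big1 hM hV.
have big' : (2 * d * d <= deficit_after d n s1)%N := deficit_after_big_mono (leqnSn _) big1.
have up s : (s0 <= s <= s1)%N -> (s0 <= s <= s1.+1)%N.
  by move=> /andP[-> /leqW].
have {}IH := IH big big' (fun s ls => hM s (up s ls)) (fun s ls => hV s (up s ls)).
have s1in : (s0 <= s1 <= s1.+1)%N by rewrite big leqnSn.
have {hM} hM := hM s1 s1in; have {hV} hV := hV s1 s1in.
have adv := ffact_advance big'.
have E0 := ff0 s1 big'.
have m8 := deficit_after_ge8 R d_ge2 big'.
have inv := @invr_deficit_afterS R _ _ d_ge2 _ big1.
have rS := deficit_afterS R d_ge2 big'.
rewrite min_clockS.
set E := expect d s1 (fun _ => ffact_deg) in IH hM hV adv E0.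
set E' := expect d s1.+1 _ in adv *.
set EL := expect d s1 _ in hV adv.
set b0 := expect d s0 _ / _ in IH *.
set m : R := (deficit_after d n s1)%:R in IH hM hV adv m8 inv rS *.
set m' : R := (deficit_after d n s1.+1)%:R in inv rS *.
set l1 := min_clock R d n s1 in IH *; set l0 := min_clock R d n s0 in IH *.
have mp : 0 < m by lra.
have m'p : 0 < m' by lra.
have mm : m' / m = 1 - 2 / m by rewrite rS; field; rewrite gt_eqF.
set q := (m' / m) ^+ k.
have q0 : 0 < q by rewrite exprn_gt0 // divr_gt0.
have y01 : 0 <= 2 / m <= 1.
  by apply/andP; split; [rewrite divr_ge0 // ltW | rewrite ler_pdivrMr //; lra].
have qu : q <= 1 - k%:R * (2 / m) + k%:R ^+ 2 * (2 / m) ^+ 2.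
  by rewrite /q mm; apply: bernoulli2.
have q2 : q^-1 <= 2 ^+ k.
  rewrite /q -exprVn lerXn2r ?nnegrE ?invr_ge0 ?divr_ge0 //; try lra.
  by rewrite invf_div ler_pdivrMr //; lra.
set b := E / m ^+ k in IH.
(* The normalised moment b changes by the losses in one step only. *)
have mk : 0 < m ^+ k by rewrite exprn_gt0.
have EE : E = b * m ^+ k by rewrite /b divfK // gt_eqF.
have b0' : 0 <= b by rewrite divr_ge0 // ltW.
have bM : b <= M by rewrite /b ler_pdivrMr.
have k0 : 0 <= k%:R :> R by [].
set c := k%:R in k0 qu hV adv *.
have d0 : 0 <= d%:R :> R by [].
set D := d%:R in d0 adv *.
pose c3 := 4 * c ^+ 2 + c * (4 * D ^+ 3) + c ^+ 2 * (2 * D ^+ 2).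
have c30 : 0 <= c3 by rewrite !addr_ge0 ?mulr_ge0 ?exprn_ge0.
have mkS : m ^+ k.+1 = m ^+ k * m by rewrite exprSr.
have im2 : 0 < m^-2 by rewrite invr_gt0 exprn_gt0.
have h1 : m ^+ k * (b * q - c3 * b / m ^+ 2 - c * (2 * D ^+ 2) * V / m) <= E'.
  apply: le_trans adv.
  have z0 : 0 <= c * (2 * D ^+ 2) / m ^+ 2 by rewrite divr_ge0 ?mulr_ge0 ?exprn_ge0 // ltW.
  have := ler_wpM2l z0 hV; rewrite mkS => z1.
  have z2 : c * (2 * D ^+ 2) / m ^+ 2 * (c * E + V * (m ^+ k * m)) =
    m ^+ k * (c ^+ 2 * (2 * D ^+ 2) * b / m ^+ 2 + c * (2 * D ^+ 2) * V / m).
    by rewrite EE; field; rewrite gt_eqF.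
  rewrite z2 in z1.
  apply: le_trans (lerB (lexx _) z1).
  rewrite EE [_ * (b * _)]mulrA [_ * m ^+ k]mulrC -mulrBr ler_pM2l //.
  have := ler_wpM2l b0' qu.
  have -> : b * (1 - c * (2 / m) + c ^+ 2 * (2 / m) ^+ 2)
     = b * (1 - c * (2 / m)) + 4 * c ^+ 2 * b / m ^+ 2 by field; rewrite gt_eqF.
  rewrite /c3; lra.
have m'k : m' ^+ k = m ^+ k * q by rewrite /q -exprMn mulrC divfK // gt_eqF.
have h2 : b - 2 ^+ k * (c3 * M / m ^+ 2 + c * (2 * D ^+ 2) * V / m) <= E' / m' ^+ k.
  rewrite m'k ler_pdivlMr ?mulr_gt0 //; apply: le_trans h1.
  rewrite mulrCA ler_pM2l //.
  set w := c3 * M / m ^+ 2 + _.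
  have w1 : c3 * b / m ^+ 2 + c * (2 * D ^+ 2) * V / m <= w.
    by rewrite /w lerD2r ler_pM2r // ler_wpM2l.
  have w0 : 0 <= w.
    apply: le_trans w1; apply: addr_ge0; apply: divr_ge0; rewrite ?(ltW mp) ?exprn_ge0 ?(ltW mp) //.
      exact: mulr_ge0.
    by apply: mulr_ge0 => //; apply: mulr_ge0 => //; apply: mulr_ge0 => //; exact: exprn_ge0.
  have : 1 <= 2 ^+ k * q by rewrite -ler_pdivrMr // div1r.
  move=> /(ler_wpM2r w0); lra.
apply: le_trans h2.
apply: (@le_trans _ _ (b0 - drift_const * M / m - 2 ^+ k * (c * D ^+ 2) * V * (l1 - l0)
   - 2 ^+ k * (c3 * M / m ^+ 2 + c * (2 * D ^+ 2) * V / m))); last by rewrite lerD2r.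
have M0 : 0 <= M by apply: le_trans bM.
have dc : drift_const = 2 ^+ k * c3 by [].
have := ler_wpM2l (mulr_ge0 drift_const_ge0 M0) inv.
rewrite dc; lra.
Qed.

End Moments.

(** * Regular states *)

Lemma profile_index d i (j := (d.-1 - i.+1)%N) : (i < d.-1)%N ->
  [/\ (d.-1 - i = j.+1)%N, (d - 1 - i = j.+1)%N, (j < d.-1)%N, (j.+1 <= d)%N & (i <= d.-1)%N].
Proof. by rewrite /j => id; split; lia. Qed.

Lemma pred_sub_lt d i : (2 <= d)%N -> (d.-1 - i < d)%N.
Proof. by move=> ?; lia. Qed.

Lemma pred_sub_split d i j : (i < j)%N -> (j <= d.-1)%N ->
  (d.-1 - i = d.-1 - j + (j - i))%N.
Proof. by move=> ? ?; lia. Qed.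

Section Regular.
Variables (R : realType) (d n : nat).
Hypothesis d_ge2 : (2 <= d)%N.
Implicit Types (G : graph n) (v : 'I_n).

(** Error constants for the number of vertices of degree d - 1 - i, obtained by going
down from the degree d - 1. *)
Fixpoint profile_err (i : nat) : R :=
  if i is i'.+1 then 2 * (d%:R * profile_err i' + 1 + ((d - 1) ^_ i)%:R)
  else 4 * d%:R ^+ 2 * (d%:R + 1).

Lemma profile_err_ge0 i : 0 <= profile_err i.
Proof.
elim: i => [|i IH] /=; first by rewrite !mulr_ge0 ?addr_ge0 ?exprn_ge0.
by rewrite mulr_ge0 ?addr_ge0 ?mulr_ge0.
Qed.

(** The bound on the imbalances is [eta] times the scale of the number of vertices of
degree 0, the rarest unsaturated degree; so they are negligible at all degrees. *)
Definition regular (eta L x : R) G : Prop :=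
  `|x - L| <= eta * L /\
  forall i, (i < d.-1)%N -> `|imbalance i.+1 x G| <= eta * (deficit d G)%:R / L ^+ d.-1.

Lemma unsat_top G : #|unsat d G|%:R = low R d G + (num_deg d.-1 G)%:R.
Proof.
rewrite num_deg_sum /low -big_split /= -sum1_card natr_sum big_mkcond /=.
apply: eq_bigr => v _; rewrite in_unsat -natrD.
by have := d_ge2; case: (ltngtP (deg G v) d) => ?; case: (ltngtP (deg G v).+1 d) => ?;
  case: (eqVneq (deg G v) d.-1) => ? //=; lia.
Qed.

Variables (eta L x : R) (G : graph n).
Hypothesis eta_gt0 : 0 < eta.
Hypothesis eta_le : eta <= 1 / 2.
Hypothesis eta_L : 1 <= eta * L.
Hypothesis reg : regular eta L x G.
Let m : R := (deficit d G)%:R.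

Let L0 : 0 < L.
Proof. by rewrite -(pmulr_rgt0 _ eta_gt0); exact: lt_le_trans ltr01 eta_L. Qed.
Let L1 : 1 <= L.
Proof.
by apply: (le_trans eta_L); apply: ler_piMl; [exact: ltW | apply: (le_trans eta_le); lra].
Qed.
Let m0 : 0 <= m. Proof. by []. Qed.

Lemma regular_clock : L / 2 <= x.
Proof.
case: reg => + _; rewrite ler_norml => /andP[+ _].
have : eta * L <= 1 / 2 * L by apply: ler_wpM2r => //; exact: ltW.
lra.
Qed.

(** Since x is at least L/2, the vertices of low degree are a fraction O(1/L) of the
deficit, and 1/L is at most [eta]. *)
Lemma regular_low : low R d G <= 4 * d%:R ^+ 2 * eta * m.
Proof.
have xL := regular_clock; have [_ imbB] := reg.
have x0 : 0 <= x by have := L0; lra.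
have lw := low_le_imbalance d_ge2 G x0.
have um := unsat_le_deficit R d G; rewrite -/m in um.
have lG := low_ge0 R d G.
have d2 : 2 <= d%:R :> R by rewrite ler_nat.
have sB : \sum_(i < d.-1) `|imbalance i.+1 x G| <= d%:R * m.
  apply: (@le_trans _ _ (\sum_(i < d.-1) m)).
    apply: ler_sum => i _; apply: le_trans (imbB _ (ltn_ord i)) _.
    rewrite ler_pdivrMr ?exprn_gt0 // -/m.
    have : 1 <= L ^+ d.-1 by rewrite exprn_ege1.
    by have := eta_le; have := m0; nra.
  by rewrite sumr_const card_ord -[_ *+ _]mulr_natl ler_wpM2r // ler_nat leq_pred.
have h1 : L / 2 * low R d G <= 2 * d%:R ^+ 2 * m.
  apply: (@le_trans _ _ ((1 + x) * low R d G)).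
    by rewrite ler_wpM2r //; lra.
  apply: (le_trans lw); set S := \sum_(i < _) _ in sB *.
  have : d%:R ^+ 2 * #|unsat d G|%:R <= d%:R ^+ 2 * m by rewrite ler_wpM2l // exprn_ge0.
  have : d%:R * m <= d%:R ^+ 2 * m by rewrite ler_wpM2r // expr2; nra.
  lra.
have h2 : eta * (L / 2 * low R d G) <= eta * (2 * d%:R ^+ 2 * m) by rewrite ler_pM2l.
have h3 : low R d G <= eta * L * low R d G by rewrite ler_peMl.
lra.
Qed.

(** At degree d - 1 the claim is that almost the whole deficit is carried by vertices
lacking one edge.  To go from j + 1 down to j, solve the equation that defines the
imbalance for D_j; both the imbalance and the replacement of x by L cost a relative
error O(eta). *)
Lemma regular_profile i : (i <= d.-1)%N ->
  `|(num_deg (d.-1 - i) G)%:R - m * ((d - 1) ^_ i)%:R / L ^+ i|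
   <= profile_err i * eta * m / L ^+ i.
Proof.
elim: i => [|i IH] id.
  rewrite subn0 ffactn0 expr0 !divr1 mulr1 /=.
  have lw := regular_low; have ut := unsat_top G.
  have um := unsat_le_deficit R d G; rewrite -/m in um.
  have dl := deficit_sub_unsat_le R d_ge2 G; rewrite -/m in dl.
  have lG := low_ge0 R d G.
  have d0 : 0 <= d%:R :> R by [].
  set l := low R d G in lw ut dl lG.
  have h : (d%:R + 1) * l <= (d%:R + 1) * (4 * d%:R ^+ 2 * eta * m).
    by rewrite ler_wpM2l // addr_ge0.
  rewrite ler_norml; apply/andP; split; first by lra.
  have : 0 <= 4 * d%:R ^+ 2 * (d%:R + 1) * eta * m.
    by rewrite !mulr_ge0 ?addr_ge0 ?exprn_ge0 // ltW.
  lra.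
have {IH} := IH (ltnW id); rewrite ler_norml => /andP[IHl IHu].
set j := (d.-1 - i.+1)%N.
have [jE jE' jd jd' id'] := profile_index id; rewrite -/j in jE jE' jd jd'.
rewrite jE in IHl IHu.
have xL := regular_clock; have [+ imbB] := reg.
rewrite ler_norml => /andP[xl xu].
have := imbB j jd; rewrite imbalanceS ler_norml -/m => /andP[Sl Su].
set D := (num_deg j G)%:R in Sl Su *.
set D1 := (num_deg j.+1 G)%:R in Sl Su IHl IHu.
have fE : ((d - 1) ^_ i.+1)%:R = ((d - 1) ^_ i)%:R * j.+1%:R :> R.
  by rewrite ffactnSr natrM; rewrite jE'.
set c := ((d - 1) ^_ i)%:R in fE IHl IHu.
set c1 := ((d - 1) ^_ i.+1)%:R in fE.
have -> : ((d - 1) ^_ i.+1)%:R = c1 by [].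
have j0 : 0 <= j.+1%:R :> R by [].
have jdR : j.+1%:R <= d%:R :> R by rewrite ler_nat.
have Li : 0 < L ^+ i by rewrite exprn_gt0.
have LS : L ^+ i.+1 = L ^+ i * L by rewrite exprSr.
have Lid : L ^+ i <= L ^+ d.-1 by rewrite ler_weXn2l.
have Ld : 0 < L ^+ d.-1 by rewrite exprn_gt0.
have em : 0 <= eta * m by rewrite mulr_ge0 // ltW.
have SB : eta * m / L ^+ d.-1 <= eta * m / L ^+ i.
  by apply: ler_wpM2l => //; rewrite lef_pV2.
have p0 := profile_err_ge0 i.
have c10 : 0 <= c1 by [].
rewrite [profile_err i.+1]/= -/c1.
set p := profile_err i in p0 IHl IHu *.
set w := eta * m / L ^+ i in SB.
have w0 : 0 <= w by rewrite divr_ge0 // ltW.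
set F := m * c1 / L ^+ i.+1.
have LF : L * F = j.+1%:R * (m * c / L ^+ i).
  by rewrite /F fE LS; field; rewrite !gt_eqF.
have pw : p * eta * m / L ^+ i = p * w by rewrite /w; ring.
rewrite pw in IHl IHu.
have eLF : eta * (L * F) = c1 * w.
  by rewrite /F /w LS; field; rewrite !gt_eqF.
have F0 : 0 <= F by rewrite divr_ge0 ?mulr_ge0 // exprn_ge0 // ltW.
have -> : 2 * (d%:R * p + 1 + c1) * eta * m / L ^+ i.+1 = 2 * (d%:R * p + 1 + c1) * w / L.
  by rewrite /w LS; field; rewrite !gt_eqF.
(* The predicted numbers satisfy (j+1) F_(j+1) = L F_j exactly. *)
have key : `|x * (D - F)| <= (d%:R * p + 1 + c1) * w.
  have -> : x * (D - F) = j.+1%:R * (D1 - m * c / L ^+ i) - (j.+1%:R * D1 - x * D)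
      + (L - x) * F by rewrite mulrBr mulrBr mulrBl LF; ring.
  have k1 : `|j.+1%:R * (D1 - m * c / L ^+ i)| <= d%:R * (p * w).
    rewrite normrM ger0_norm //; apply: ler_pM => //.
    by rewrite ler_norml; apply/andP; split; lra.
  have k2 : `|j.+1%:R * D1 - x * D| <= w by rewrite ler_norml; apply/andP; split; lra.
  have k3 : `|(L - x) * F| <= c1 * w.
    rewrite -eLF normrM (ger0_norm F0) mulrA; apply: ler_wpM2r => //.
    by rewrite ler_norml; apply/andP; split; lra.
  apply: (le_trans (ler_normD _ _)); apply: (le_trans (lerD (ler_normB _ _) k3)).
  by move: k1 k2; lra.
have x0 : 0 < x by apply: lt_le_trans xL; rewrite divr_gt0.
rewrite -(ler_pM2l x0).
rewrite -[X in X * `|_|](gtr0_norm x0) -normrM; apply: (le_trans key).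
set Z := (d%:R * p + 1 + c1) * w.
have Z0 : 0 <= Z by rewrite mulr_ge0 // !addr_ge0 // mulr_ge0.
have -> : x * (2 * (d%:R * p + 1 + c1) * w / L) = Z * (2 * x / L) by rewrite /Z; ring.
apply: ler_peMr => //; rewrite ler_pdivlMr //; lra.
Qed.

Lemma weighted_count_geom (r : R) j : weighted_count (geom_weight r j) G =
  \sum_(i < j.+1) r^-1 ^+ (j - i) * (num_deg i G)%:R.
Proof.
under [RHS]eq_bigr do rewrite num_deg_sum mulr_sumr.
rewrite exchange_big /=; apply: eq_bigr => v _; rewrite /geom_weight.
case: (leqP (deg G v) j) => vj.
  have lt : (deg G v < j.+1)%N by [].
  rewrite (bigD1 (Ordinal lt)) //= eqxx mulr1 big1 ?addr0 // => i ne.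
  by case: eqP => vi; rewrite ?mulr0 //; case/eqP: ne; apply/val_inj.
rewrite big1 // => i _; case: eqP => vi; rewrite ?mulr0 //.
by have := ltn_ord i; rewrite ltnS -vi leqNgt vj.
Qed.

Definition profile_bound : R := \sum_(i < d) (profile_err i + ((d - 1) ^_ i)%:R).

Lemma profile_bound_ge i : (i < d)%N ->
  profile_err i + ((d - 1) ^_ i)%:R <= profile_bound.
Proof.
move=> id; rewrite /profile_bound (bigD1 (Ordinal id)) //= lerDl.
by apply: sumr_ge0 => a _; rewrite addr_ge0 ?profile_err_ge0.
Qed.

Lemma regular_num_deg_le i : (i <= d.-1)%N ->
  (num_deg i G)%:R <= profile_bound * m / L ^+ (d.-1 - i).
Proof.
move=> id; have := @regular_profile (d.-1 - i) (leq_subr _ _).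
rewrite subKn // ler_norml => /andP[_]; set a := (d.-1 - i)%N => h.
have ad : (a < d)%N := pred_sub_lt _ d_ge2.
have pb := profile_bound_ge ad; have p0 := profile_err_ge0 a.
have La : 0 < m / L ^+ a \/ m / L ^+ a = 0.
  by case: (ltrgtP 0 m) (m0) => // [h0 _|<- _]; [left; rewrite divr_gt0 // exprn_gt0 | right; rewrite mul0r].
have w0 : 0 <= m / L ^+ a by case: La => [/ltW|->].
set c := ((d - 1) ^_ a)%:R in h pb.
have e1 : m * c / L ^+ a = c * (m / L ^+ a) by ring.
have e2 : profile_err a * eta * m / L ^+ a = profile_err a * eta * (m / L ^+ a) by ring.
rewrite e1 e2 in h; rewrite -mulrA.
have e3 : profile_err a * eta <= profile_err a by have := eta_le; nra.
have := ler_wpM2r w0 e3; have := ler_wpM2r w0 pb; lra.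
Qed.

(** A step down in degree multiplies the weight by eta L and the number of vertices by
O(1/L), so all degrees below [j] together contribute a fraction O(eta). *)
Lemma regular_weighted_count j : (j <= d.-1)%N ->
  weighted_count (geom_weight (eta * L)^-1 j) G <=
  (((d - 1) ^_ (d.-1 - j))%:R + (d%:R + 1) * profile_bound * eta) * m / L ^+ (d.-1 - j).
Proof.
move=> jd; rewrite weighted_count_geom big_ord_recr /= subnn expr0 mul1r invrK.
set a := (d.-1 - j)%N.
have La : 0 < L ^+ a by rewrite exprn_gt0.
have w0 : 0 <= m / L ^+ a by rewrite divr_ge0 // ltW.
have pb0 : 0 <= profile_bound by apply: sumr_ge0 => i _; rewrite addr_ge0 ?profile_err_ge0.
have h1 : \sum_(i < j) (eta * L) ^+ (j - i) * (num_deg i G)%:R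
    <= d%:R * profile_bound * eta * (m / L ^+ a).
  apply: (@le_trans _ _ (\sum_(i < j) profile_bound * eta * (m / L ^+ a))); last first.
    rewrite sumr_const card_ord -[_ *+ _]mulr_natl -[d%:R * _ * _]mulrA -[leRHS]mulrA.
    apply: ler_wpM2r; first by rewrite mulr_ge0 // mulr_ge0 // ltW.
    by rewrite ler_nat (leq_trans jd) // leq_pred.
  apply: ler_sum => i _; have ij := ltn_ord i.
  have id : (i <= d.-1)%N := leq_trans (ltnW ij) jd.
  apply: (@le_trans _ _ ((eta * L) ^+ (j - i) * (profile_bound * m / L ^+ (d.-1 - i)))).
    by rewrite ler_wpM2l ?regular_num_deg_le // exprn_ge0 // mulr_ge0 // ltW.
  rewrite (pred_sub_split ij jd) -/a.
  rewrite exprMn exprD.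
  have Lji : L ^+ (j - i) != 0 by rewrite expf_neq0 // gt_eqF.
  have -> : eta ^+ (j - i) * L ^+ (j - i) * (profile_bound * m / (L ^+ a * L ^+ (j - i)))
    = profile_bound * eta ^+ (j - i) * (m / L ^+ a) by field; rewrite Lji gt_eqF.
  apply: ler_wpM2r => //; apply: ler_wpM2l => //.
  rewrite -[leRHS]expr1; apply: ler_wiXn2l; rewrite ?ltW ?subn_gt0 //.
  by have := eta_le; lra.
have := @regular_profile a (leq_subr _ _); rewrite subKn // ler_norml => /andP[_ h2].
have ad : (a < d)%N := pred_sub_lt _ d_ge2.
have pb := profile_bound_ge ad; have p0 := profile_err_ge0 a.
set c := ((d - 1) ^_ a)%:R in h2 pb *.
have c0 : 0 <= c by [].
have e1 : m * c / L ^+ a = c * (m / L ^+ a) by ring.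
have e2 : profile_err a * eta * m / L ^+ a = profile_err a * eta * (m / L ^+ a) by ring.
rewrite e1 e2 in h2; rewrite -mulrA.
have e3 : profile_err a * eta <= profile_bound * eta by rewrite ler_pM2r //; lra.
have := ler_wpM2r w0 e3; lra.
Qed.

End Regular.

(** * Irregular states are rare; the clock is logarithmic *)

Section Irregular.
Variables (R : realType) (d n : nat).
Hypothesis d_ge2 : (2 <= d)%N.
Implicit Types (G : graph n) (v : 'I_n) (F : R -> graph n -> R).
Variables (s : nat) (eta L B : R).
Let m : R := (deficit_after d n s)%:R.
Let del : R := eta * m / L ^+ d.-1.
Hypothesis big : (2 * d * d <= deficit_after d n s)%N.
Hypothesis eta_gt0 : 0 < eta.
Hypothesis L_gt0 : 0 < L.
Hypothesis hB : d%:R + 1 + d%:R * min_clock R d n s <= B.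
Hypothesis clock_lo : (1 - eta) * L <= min_clock R d n s.
Hypothesis clock_hi : min_clock R d n s + clock_slack R d n s + 1 <= (1 + eta) * L.

(** This dominates the indicator of the irregular states, so that its expectation
bounds their probability, as in the inequalities of Markov and Chebyshev. *)
Definition irregularity (x : R) G : R :=
  excess d n s x + (del ^+ 2)^-1 * \sum_(i < d.-1) imbalance i.+1 x G ^+ 2.

Definition irregular_bound : R :=
  B ^+ 2 / m * (excess_const R d
    + (\sum_(i < d.-1) imbalance_const R d i.+1) * (L ^+ d.-1 / eta) ^+ 2).

Let m_gt0 : 0 < m.
Proof. exact: lt_le_trans (deficit_after_ge8 R d_ge2 big). Qed.

Let del_gt0 : 0 < del.
Proof. by rewrite divr_gt0 ?mulr_gt0 ?exprn_gt0. Qed.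

Lemma irregularity_ge0 x G : 0 <= irregularity x G.
Proof.
apply: addr_ge0; first exact: excess_ge0.
by apply: mulr_ge0; [rewrite invr_ge0 sqr_ge0 | apply: sumr_ge0 => i _; exact: sqr_ge0].
Qed.

Lemma irregular_ge1 x G : reachable d s x G -> ~ regular d eta L x G ->
  1 <= irregularity x G.
Proof.
move=> Gr nreg; rewrite leNgt; apply/negP => lt1; apply: nreg.
have E := deficit_reachable d_ge2 Gr; have [_ _ /andP[xl _]] := Gr.
have S0 : 0 <= \sum_(i < d.-1) imbalance i.+1 x G ^+ 2.
  by apply: sumr_ge0 => i _; exact: sqr_ge0.
have d20 : 0 < (del ^+ 2)^-1 by rewrite invr_gt0 exprn_gt0.
have dS0 := mulr_ge0 (ltW d20) S0.
have e0 := excess_ge0 d n s x.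
split.
  have : excess d n s x < 1 by move: lt1; rewrite /irregularity; lra.
  rewrite /excess gt_max => /andP[_ x1].
  by move: x1 xl clock_lo clock_hi; rewrite ler_norml => h1 h2 h3 h4; apply/andP; split; lra.
move=> i id; rewrite E -/m -/del.
have Slt : (del ^+ 2)^-1 * \sum_(i < d.-1) imbalance i.+1 x G ^+ 2 < 1.
  by move: lt1; rewrite /irregularity; lra.
rewrite mulrC ltr_pdivrMr ?exprn_gt0 // mul1r in Slt.
rewrite -ler_sqr ?nnegrE // ?ltW // real_normK ?num_real //.
apply: le_lt_trans Slt.
rewrite (bigD1 (Ordinal id)) //= lerDl; apply: sumr_ge0 => a _; exact: sqr_ge0.
Qed.

Lemma expect_irregularity : expect d s irregularity <= irregular_bound.
Proof.
rewrite expectD expectZ expect_sum.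
have h1 := expect_excess d_ge2 big hB.
have h2 (i : 'I_d.-1) : expect d s (fun x (G : graph n) => imbalance i.+1 x G ^+ 2)
    <= imbalance_const R d i.+1 * B ^+ 2 * m.
  apply: expect_imbalance_sq => //.
  by have := ltn_ord i; rewrite ltn_predRL.
have d20 : 0 <= (del ^+ 2)^-1 by rewrite invr_ge0 exprn_ge0 // ltW.
apply: (le_trans (lerD h1 (ler_wpM2l d20 (ler_sum _ (fun i _ => h2 i))))).
rewrite -!mulr_suml -/m /irregular_bound /del le_eqVlt; apply/orP; left; apply/eqP.
have Ld : L ^+ d.-1 != 0 by rewrite expf_neq0 // gt_eqF.
by field; rewrite Ld !gt_eqF.
Qed.

Lemma expect_le_regular F a M : 0 <= a -> 0 <= M ->
  (forall x G, reachable d s x G -> regular d eta L x G -> F x G <= a) ->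
  (forall x G, reachable d s x G -> F x G <= M) ->
  expect d s F <= a + M * irregular_bound.
Proof.
move=> a0 M0 Fa FM.
apply: (@le_trans _ _ (expect d s (fun x G => a + M * irregularity x G))).
  apply: expect_le => // x G Gr.
  have [rg|nrg] := pselect (regular d eta L x G).
    by apply: (le_trans (Fa x G Gr rg)); rewrite lerDl mulr_ge0 ?irregularity_ge0.
  have := ler_wpM2l M0 (irregular_ge1 Gr nrg); have := FM x G Gr; lra.
by rewrite expectD expectZ expect_cst lerD2l ler_wpM2l ?expect_irregularity.
Qed.

Lemma expect_ge_regular F a : 0 <= a ->
  (forall x G, reachable d s x G -> regular d eta L x G -> a <= F x G) ->
  (forall x G, reachable d s x G -> 0 <= F x G) ->
  a * (1 - irregular_bound) <= expect d s F.
Proof.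
move=> a0 Fa F0.
apply: (@le_trans _ _ (expect d s (fun x G => a + (- a) * irregularity x G))).
  rewrite expectD expectZ expect_cst.
  have := ler_wpM2l a0 expect_irregularity; lra.
apply: expect_le => // x G Gr.
have [rg|nrg] := pselect (regular d eta L x G).
  apply: le_trans (Fa x G Gr rg); rewrite gerDl mulNr oppr_le0 mulr_ge0 ?irregularity_ge0 //.
have := ler_wpM2l a0 (irregular_ge1 Gr nrg); have := F0 x G Gr; lra.
Qed.

End Irregular.

Section LogClock.
Variables (R : realType) (d n : nat).
Hypothesis d_ge2 : (2 <= d)%N.

Lemma ln_ratio_le (a b : R) : 0 < a -> 0 < b -> ln a - ln b <= (a - b) / b.
Proof.
move=> a0 b0; rewrite -ln_div ?posrE //.
have -> : a / b = 1 + (a - b) / b by field; rewrite gt_eqF.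
by apply: le_ln1Dx; rewrite ltr_pdivlMr // mulN1r; lra.
Qed.

(** The minimal clock is a Riemann sum of 1/m. *)
Lemma min_clock_diff_le s0 s1 : (s0 <= s1)%N -> (2 * d * d <= deficit_after d n s1)%N ->
  min_clock R d n s1 - min_clock R d n s0 <= ln (deficit_after d n s0)%:R - ln (deficit_after d n s1)%:R.
Proof.
elim: s1 => [|s1 IH]; first by rewrite leqn0 => /eqP -> _; rewrite !subrr.
rewrite leq_eqVlt => /orP[/eqP <- _|]; first by rewrite !subrr.
rewrite ltnS => ss big.
have big' : (2 * d * d <= deficit_after d n s1)%N := deficit_after_big_mono (leqnSn _) big.
have {}IH := IH ss big'.
have m8 := deficit_after_ge8 R d_ge2 big'.
rewrite min_clockS deficit_afterS //; set m : R := (deficit_after d n s1)%:R in IH m8 *.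
have m2 : 0 < m - 2 by lra.
have m0 : 0 < m by lra.
have := ln_ratio_le m2 m0; have -> : (m - 2 - m) / m = - (2 / m) by ring.
lra.
Qed.

Lemma min_clock_ge_ln s : (2 * d * d <= deficit_after d n s)%N ->
  ln ((d * n)%:R + 2) - ln ((deficit_after d n s)%:R + 2) <= min_clock R d n s.
Proof.
elim: s => [|s IH] big; first by rewrite /deficit_after muln0 subn0 subrr min_clock0.
have big' : (2 * d * d <= deficit_after d n s)%N := deficit_after_big_mono (leqnSn _) big.
have {}IH := IH big'.
have m8 := deficit_after_ge8 R d_ge2 big'.
rewrite min_clockS deficit_afterS //; set m : R := (deficit_after d n s)%:R in IH m8 *.
have m0 : 0 < m by lra.
have m2 : 0 < m + 2 by lra.
have := ln_ratio_le m2 m0; have -> : (m + 2 - m) / m = 2 / m by ring.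
rewrite subrK; lra.
Qed.

End LogClock.

(** * The moment bound for a fixed number of vertices *)

Lemma exprn_1D_le (R : realType) (C eta : R) k : 0 <= C -> 0 <= eta <= 1 ->
  (1 + C * eta) ^+ k <= 1 + (1 + C) ^+ k * eta.
Proof.
move=> C0 /andP[e0 e1].
suff : (1 + C * eta) ^+ k <= 1 + ((1 + C) ^+ k - 1) * eta by lra.
elim: k => [|k IH]; first by rewrite !expr0 subrr mul0r addr0.
rewrite !exprSr; set X := (1 + C) ^+ k in IH *.
have X1 : 0 <= X - 1 by rewrite subr_ge0 exprn_ege1 // lerDl.
have Ce : 0 <= C * eta by exact: mulr_ge0.
apply: (@le_trans _ _ ((1 + (X - 1) * eta) * (1 + C * eta))).
  by rewrite ler_wpM2r // addr_ge0.
have := mulr_ge0 (mulr_ge0 (mulr_ge0 C0 X1) e0) (_ : 0 <= 1 - eta).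
by rewrite subr_ge0 => /(_ e1); nra.
Qed.

Lemma expR_le_1D2 (R : realType) (y : R) : 0 <= y -> y <= 1 / 2 -> expR y <= 1 + 2 * y.
Proof.
move=> y0 y1; have := expR_ge1Dx (- y); rewrite expRN => h.
have e0 := expR_gt0 y.
have h2 : (1 - y) * expR y <= 1 by rewrite -ler_pdivlMr // div1r; lra.
nra.
Qed.

Lemma ffact_ge_exp (R : realType) (D k : nat) (y : R) : 0 <= y -> y <= D%:R - k%:R ->
  y ^+ k <= (D ^_ k)%:R.
Proof.
move=> y0 yD.
have kD : (k <= D)%N by rewrite -(ler_nat R); lra.
apply: (@le_trans _ _ ((D - k) ^ k)%:R).
  by rewrite natrX lerXn2r ?nnegrE // natrB.
rewrite ler_nat.
have : forall i, (i <= k)%N -> ((D - k) ^ i <= D ^_ i)%N.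
  elim=> [|i IH] ik; first by rewrite expn0 ffactn0.
  by rewrite expnSr ffactnSr leq_mul ?IH ?(ltnW ik) // leq_sub2l // ltnW.
exact.
Qed.

Lemma pred_sub_bounds d j (a := (d.-1 - j)%N) : (j < d.-1)%N ->
  [/\ (a <= d - 1)%N, (a <= d)%N & (j < d)%N].
Proof. by rewrite /a => ?; split; lia. Qed.

Lemma sub2_bounds d : (2 <= d)%N ->
  [/\ (d - 2 <= d.-1)%N, (d.-1 - (d - 2) = 1)%N, (d - 2 < d)%N & (d.+1 <= d + d)%N].
Proof. by move=> ?; split; lia. Qed.

(** In the use below [b] is the expected density of vertices of degree j, which has to
be extracted from the crude bound for irregular states. *)
Lemma exprn_rescale (R : realType) (b m l : R) k : b != 0 ->
  (m * l) ^+ k = (b * m) ^+ k * (b^-1 * l) ^+ k.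
Proof. by move=> b0; rewrite -exprMn; congr (_ ^+ _); field. Qed.

Section FiniteBound.
Variables (R : realType) (d n : nat).
Hypothesis d_ge2 : (2 <= d)%N.
Implicit Types (G : graph n) (v : 'I_n).
Variables (j k s0 s1 : nat) (eta L B : R).
Hypothesis jd : (j < d.-1)%N.
Hypothesis s01 : (s0 <= s1)%N.
Hypothesis big : (2 * d * d <= deficit_after d n s1)%N.
Hypothesis eta_gt0 : 0 < eta.
Hypothesis eta_le : eta <= 1 / 2.
Hypothesis eta_L : 1 <= eta * L.
Hypothesis hB : d%:R + 1 + d%:R * min_clock R d n s0 <= B.
Hypothesis clock_lo : (1 - eta) * L <= min_clock R d n s0.
Hypothesis clock_hi : min_clock R d n s0 + clock_slack R d n s0 + 1 <= (1 + eta) * L.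
Let P := irregular_bound d n s0 eta L B.
Hypothesis P_small : L ^+ (2 * d * k.+1) * P <= eta.
Let r := (eta * L)^-1.
Hypothesis growth_le : forall K s, (K <= k.+1)%N -> (s0 <= s <= s1)%N ->
  growth d n r K s0 s <= eta.
Let a := (d.-1 - j)%N.
Let c : R := ((d - 1) ^_ a)%:R.
Let beta : R := c / L ^+ a.
Let m0 : R := (deficit_after d n s0)%:R.
Let m1 : R := (deficit_after d n s1)%:R.
Hypothesis k_small : k%:R <= eta * (beta * m0).
Hypothesis m1_big : m1^-1 <= eta.
Hypothesis clock_diff : min_clock R d n s1 - min_clock R d n s0 <= eta * L.
Hypothesis err_small : (profile_err R d a + 1) * eta <= 1.

Let big0 : (2 * d * d <= deficit_after d n s0)%N. Proof. exact: deficit_after_big_mono s01 big. Qed.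
Let L_gt0 : 0 < L.
Proof. by rewrite -(pmulr_rgt0 _ eta_gt0); exact: lt_le_trans ltr01 eta_L. Qed.
Let L_ge1 : 1 <= L.
Proof.
by apply: (le_trans eta_L); apply: ler_piMl; [exact: ltW | apply: (le_trans eta_le); lra].
Qed.
Let m0_gt0 : 0 < m0. Proof. exact: lt_le_trans (deficit_after_ge8 R d_ge2 big0). Qed.
Let m1_gt0 : 0 < m1. Proof. exact: lt_le_trans (deficit_after_ge8 R d_ge2 big). Qed.
Let c_ge1 : 1 <= c.
Proof. by rewrite /c (ler_nat _ 1) ffact_gt0; have [] := pred_sub_bounds jd. Qed.
Let beta_gt0 : 0 < beta.
Proof. by rewrite divr_gt0 ?exprn_gt0 //; exact: lt_le_trans ltr01 c_ge1. Qed.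
Let r01 : 0 < r <= 1.
Proof.
have h : 0 < eta * L by exact: lt_le_trans ltr01 eta_L.
by rewrite invr_gt0 h invf_le1.
Qed.
Let jd' : (j < d)%N. Proof. by have [] := pred_sub_bounds jd. Qed.

Let C : R := (d%:R + 1) * profile_bound R d.

Let C_ge0 : 0 <= C.
Proof.
rewrite mulr_ge0 ?addr_ge0 // sumr_ge0 // => i _.
by rewrite addr_ge0 ?profile_err_ge0.
Qed.

Let P_ge0 : 0 <= P.
Proof.
apply: mulr_ge0; first by rewrite divr_ge0 ?sqr_ge0 // ltW.
apply: addr_ge0; first exact: excess_const_ge0.
by rewrite mulr_ge0 ?sqr_ge0 ?sumr_ge0 // => i _; exact: imbalance_const_ge0.
Qed.

Let P_le e : (e <= 2 * d * k.+1)%N -> L ^+ e * P <= eta.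
Proof. by move=> el; apply: le_trans P_small; rewrite ler_wpM2r // ler_weXn2l. Qed.

(** The crude bound for irregular states: it loses a power of [L], which is paid for by
their small probability. *)
Lemma weighted_count_le_all s (x : R) G i : reachable d s x G -> (i < d)%N ->
  weighted_count (geom_weight r i) G <= (deficit_after d n s)%:R * L ^+ d.
Proof.
move=> Gr id; have E := deficit_reachable d_ge2 Gr; have [Gwf _ _] := Gr.
have um := unsat_le_deficit R d G; rewrite E in um.
have Ld : 0 <= L ^+ d by rewrite exprn_ge0 // ltW.
apply: le_trans (ler_wpM2r Ld um).
rewrite -sum1_card natr_sum mulr_suml [leRHS]big_mkcond /=.
apply: ler_sum => v _; rewrite in_unsat mul1r /geom_weight.
have := Gwf.2 v; rewrite leq_eqVlt => /orP[/eqP ->|vd].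
  by rewrite ltnn leqNgt id.
rewrite vd; case: ifP => // vi.
rewrite invrK; apply: (@le_trans _ _ (L ^+ (i - deg G v))).
  apply: lerXn2r; rewrite ?nnegrE; [by apply: le_trans eta_L | exact: ltW|].
  by apply: ler_piMl; [exact: ltW | apply: (le_trans eta_le); lra].
by apply: ler_weXn2l => //; rewrite (leq_trans (leq_subr _ _)) // ltnW.
Qed.

Let regular_weighted i (x : R) G : (i <= d.-1)%N -> reachable d s0 x G -> regular d eta L x G ->
  weighted_count (geom_weight r i) G <=
  (((d - 1) ^_ (d.-1 - i))%:R + C * eta) * m0 / L ^+ (d.-1 - i).
Proof.
move=> id Gr rg; have E := deficit_reachable d_ge2 Gr.
have := regular_weighted_count d_ge2 eta_gt0 eta_le eta_L rg id.
by rewrite E.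
Qed.

Let wc_ge0 i G : 0 <= weighted_count (geom_weight r i) G.
Proof. by apply: sumr_ge0 => v _; apply: geom_weight_ge0; case/andP: r01 => /ltW. Qed.

Let regular_weighted_j (x : R) G : reachable d s0 x G -> regular d eta L x G ->
  weighted_count (geom_weight r j) G <= (1 + C * eta) * (beta * m0).
Proof.
move=> Gr rg; apply: le_trans (regular_weighted (ltnW jd) Gr rg) _.
rewrite -/a -/c.
have -> : (1 + C * eta) * (beta * m0) = (c + c * (C * eta)) * m0 / L ^+ a.
  by rewrite /beta; field; rewrite expf_neq0 // gt_eqF.
apply: ler_wpM2r; first by rewrite invr_ge0 exprn_ge0 // ltW.
apply: ler_wpM2r; first exact: ltW.
by rewrite lerD2l ler_peMl // mulr_ge0 // ltW.
Qed.

Let inv_beta : beta^-1 <= L ^+ d.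
Proof.
rewrite /beta invf_div; apply: (@le_trans _ _ (L ^+ a)).
  rewrite ler_pdivrMr; last exact: lt_le_trans ltr01 c_ge1.
  by rewrite ler_peMr // exprn_ge0 // ltW.
by apply: ler_weXn2l => //; have [] := pred_sub_bounds jd.
Qed.

Let K1 : R := (1 + C) ^+ k + 1.

Let P0_le : expect d s0 (fun _ G => weighted_count (geom_weight r j) G ^+ k)
  <= (beta * m0) ^+ k * (1 + K1 * eta).
Proof.
have bm : 0 < beta * m0 by exact: mulr_gt0.
have Ce : 0 <= 1 + C * eta by rewrite addr_ge0 // mulr_ge0 // ltW.
have mL : 0 <= m0 * L ^+ d by rewrite mulr_ge0 ?exprn_ge0 // ltW.
apply: (@le_trans _ _ (((1 + C * eta) * (beta * m0)) ^+ k + (m0 * L ^+ d) ^+ k * P)).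
  apply: expect_le_regular => //.
  - by rewrite exprn_ge0 // mulr_ge0 // ltW.
  - by rewrite exprn_ge0.
  - move=> x G Gr rg; apply: lerXn2r; rewrite ?nnegrE //; last exact: regular_weighted_j Gr rg.
    by rewrite mulr_ge0 // ltW.
  - move=> x G Gr; apply: lerXn2r; rewrite ?nnegrE //; exact: weighted_count_le_all Gr jd'.
have e01 : 0 <= eta <= 1 by rewrite ltW //=; apply: (le_trans eta_le); lra.
have h1 := exprn_1D_le k C_ge0 e01.
have h2 : (m0 * L ^+ d) ^+ k * P <= (beta * m0) ^+ k * eta.
  have -> : (m0 * L ^+ d) ^+ k * P = (beta * m0) ^+ k * ((beta^-1 * L ^+ d) ^+ k * P).
    by rewrite [RHS]mulrA -(exprn_rescale m0 (L ^+ d) k (b := beta)) // gt_eqF.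
  apply: ler_wpM2l; first by rewrite exprn_ge0 // ltW.
  apply: (@le_trans _ _ (L ^+ (2 * d * k) * P)).
    apply: ler_wpM2r => //; rewrite exprM; apply: lerXn2r.
    - by rewrite nnegrE mulr_ge0 ?exprn_ge0 ?invr_ge0 // ltW.
    - by rewrite nnegrE exprn_ge0 // ltW.
    by rewrite mul2n -addnn exprD ler_wpM2r // exprn_ge0 // ltW.
  by apply: P_le; rewrite leq_mul2l leqnSn orbT.
rewrite exprMn /K1; have bk : 0 <= (beta * m0) ^+ k by rewrite exprn_ge0 // ltW.
have := ler_wpM2l bk h1; lra.
Qed.

Let K2 : R := (1 + C) ^+ k * (d%:R + C) + 1.

Let P1_le : expect d s0 (fun _ G => weighted_count (geom_weight r j) G ^+ k
                                     * weighted_count (geom_weight r (d - 2)) G)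
  <= (beta * m0) ^+ k * (m0 / L) * K2.
Proof.
have bm : 0 < beta * m0 by exact: mulr_gt0.
have Ce : 0 <= 1 + C * eta by rewrite addr_ge0 // mulr_ge0 // ltW.
have mL : 0 <= m0 * L ^+ d by rewrite mulr_ge0 ?exprn_ge0 // ltW.
have m0L : 0 <= m0 / L by rewrite divr_ge0 // ltW.
have dC : 0 <= d%:R + C by rewrite addr_ge0.
apply: (@le_trans _ _ (((1 + C) * (beta * m0)) ^+ k * ((d%:R + C) * (m0 / L))
   + (m0 * L ^+ d) ^+ k.+1 * P)).
  have b1 : 0 <= (1 + C) * (beta * m0) by rewrite mulr_ge0 ?addr_ge0 // ltW.
  apply: expect_le_regular => //.
  - by rewrite mulr_ge0 ?exprn_ge0 // mulr_ge0.
  - by rewrite exprn_ge0.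
  - move=> x G Gr rg; apply: ler_pM; rewrite ?exprn_ge0 //.
      apply: lerXn2r; rewrite ?nnegrE //.
      apply: le_trans (regular_weighted_j Gr rg) _.
      rewrite ler_wpM2r ?(ltW bm) // lerD2l ler_piMr //.
      by apply: (le_trans eta_le); lra.
    have [id2 id1 _ _] := sub2_bounds d_ge2.
    have := regular_weighted id2 Gr rg.
    rewrite id1 ffactn1 expr1 => h; apply: (le_trans h).
    rewrite -mulrA; apply: ler_wpM2r => //; apply: lerD.
      by rewrite ler_nat leq_subr.
    by rewrite ler_piMr //; apply: (le_trans eta_le); lra.
  - move=> x G Gr; rewrite exprSr; apply: ler_pM; rewrite ?exprn_ge0 //.
      by apply: lerXn2r; rewrite ?nnegrE //; exact: weighted_count_le_all Gr jd'.
    by apply: weighted_count_le_all Gr _; have [] := sub2_bounds d_ge2.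
have h2 : (m0 * L ^+ d) ^+ k.+1 * P <= (beta * m0) ^+ k * (m0 / L).
  have -> : (m0 * L ^+ d) ^+ k.+1 * P
     = (beta * m0) ^+ k * (m0 / L) * ((beta^-1 * L ^+ d) ^+ k * L ^+ d.+1 * P).
    rewrite exprSr (exprn_rescale m0 (L ^+ d) k (b := beta)) ?gt_eqF // exprS.
    have Ln : L != 0 by rewrite gt_eqF.
    rewrite -[(beta * m0) ^+ k * _ * _]mulrA -[(beta * m0) ^+ k * _ * _]mulrA.
    rewrite -[(beta * m0) ^+ k * _ * _]mulrA; congr (_ * _).
    set Z := _ ^+ k; set W := L ^+ d; by field.
  have bm' : 0 <= (beta * m0) ^+ k * (m0 / L) by rewrite mulr_ge0 // exprn_ge0 // ltW.
  apply: ler_piMr => //.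
  apply: (@le_trans _ _ (L ^+ (2 * d * k + d.+1) * P)).
    apply: ler_wpM2r => //; rewrite exprD; apply: ler_wpM2r; first by rewrite exprn_ge0 // ltW.
    rewrite exprM; apply: lerXn2r.
    - by rewrite nnegrE mulr_ge0 ?exprn_ge0 ?invr_ge0 // ltW.
    - by rewrite nnegrE exprn_ge0 // ltW.
    by rewrite mul2n -addnn exprD ler_wpM2r // exprn_ge0 // ltW.
  apply: (@le_trans _ _ eta); last by apply: (le_trans eta_le); lra.
  by apply: P_le; rewrite mulnS addnC leq_add2r mul2n -addnn; have [] := sub2_bounds d_ge2.
rewrite /K2 exprMn.
lra.
Qed.

Let M : R := 2 * (1 + K1) * beta ^+ k.
Let V : R := 2 * K2 * beta ^+ k / L.

Let exp_le2 y : y <= eta -> expR y <= 2.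
Proof.
move=> ye; apply: (@le_trans _ _ (expR eta)); first by rewrite ler_expR.
by have := expR_le_1D2 (ltW eta_gt0) eta_le; have := eta_le; lra.
Qed.

Let K1_ge0 : 0 <= K1. Proof. by rewrite addr_ge0 // exprn_ge0 // addr_ge0. Qed.
Let K2_ge0 : 0 <= K2.
Proof. by rewrite addr_ge0 // mulr_ge0 ?exprn_ge0 ?addr_ge0. Qed.

Let upper_at s : (s0 <= s <= s1)%N ->
  expect d s (fun _ => ffact_deg R j k (n:=n)) <=
   (1 + 2 * eta) * (1 + K1 * eta) * beta ^+ k * (deficit_after d n s)%:R ^+ k.
Proof.
move=> /andP[l0 l1]; have bigs : (2 * d * d <= deficit_after d n s)%N := deficit_after_big_mono l1 big.
have ms : 0 <= (deficit_after d n s)%:R :> R by [].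
apply: le_trans (expect_ffact_upper d_ge2 k jd' r01 l0 bigs) _.
set ms' : R := (deficit_after d n s)%:R in ms *.
have gr : expR (growth d n r k s0 s) <= 1 + 2 * eta.
  apply: (@le_trans _ _ (expR eta)); last exact: expR_le_1D2 (ltW eta_gt0) eta_le.
  by rewrite ler_expR growth_le ?l0.
have q0 : 0 <= (ms' / m0) ^+ k by rewrite exprn_ge0 // divr_ge0 // ltW.
apply: (le_trans (ler_wpM2l (mulr_ge0 q0 (expR_ge0 _)) P0_le)).
have K1e : 0 <= 1 + K1 * eta by rewrite addr_ge0 // mulr_ge0 // ltW.
have Z0 : 0 <= ms' ^+ k * (beta ^+ k * (1 + K1 * eta)).
  by rewrite mulr_ge0 ?exprn_ge0 // mulr_ge0 ?exprn_ge0 // ltW.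
have -> : (ms' / m0) ^+ k * expR (growth d n r k s0 s) * ((beta * m0) ^+ k * (1 + K1 * eta))
   = expR (growth d n r k s0 s) * (ms' ^+ k * (beta ^+ k * (1 + K1 * eta))).
  have -> : ms' ^+ k = (ms' / m0) ^+ k * m0 ^+ k by rewrite -exprMn divfK // gt_eqF.
  by rewrite [(beta * m0) ^+ k]exprMn; ring.
apply: (le_trans (ler_wpM2r Z0 gr)); lra.
Qed.

Definition bound_const : R :=
  2 * (1 + K1) + 2 * K1 + 2 + (k%:R * (profile_err R d a + 1) + 1
   + drift_const R d k * (2 * (1 + K1)) + 2 ^+ k * (k%:R * d%:R ^+ 2) * (2 * K2)).

Lemma ffact_bound_upper :
  expect d s1 (fun _ => ffact_deg R j k (n:=n)) / (beta * m1) ^+ k <= 1 + bound_const * eta.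
Proof.
have bm : 0 < beta * m1 by exact: mulr_gt0.
rewrite ler_pdivrMr ?exprn_gt0 //.
have s1in : (s0 <= s1 <= s1)%N by rewrite s01 leqnn.
apply: le_trans (upper_at s1in) _; rewrite -/m1 -[_ * beta ^+ k * _]mulrA -exprMn.
apply: ler_wpM2r; first by rewrite exprn_ge0 // ltW.
have b0 : 2 + 2 * K1 <= bound_const.
  rewrite /bound_const; have dc := drift_const_ge0 R d k; have pe := profile_err_ge0 R d a.
  have h1 : 0 <= k%:R * (profile_err R d a + 1) :> R by rewrite mulr_ge0 ?addr_ge0.
  have h2 : 0 <= drift_const R d k * (2 * (1 + K1)) by rewrite mulr_ge0 // mulr_ge0 // addr_ge0.
  have h3 : 0 <= 2 ^+ k * (k%:R * d%:R ^+ 2) * (2 * K2) :> R.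
    by rewrite mulr_ge0 ?mulr_ge0 ?exprn_ge0.
  have := K1_ge0; lra.
have e0 := ltW eta_gt0.
have h4 := ler_wpM2r e0 b0.
have h5 : K1 * eta * (2 * eta) <= K1 * eta * 1.
  by apply: ler_wpM2l; [exact: mulr_ge0 | have := eta_le; lra].
lra.
Qed.

Let lower_at : (beta * m0) ^+ k * ((1 - k%:R * (profile_err R d a + 1) * eta) * (1 - P))
  <= expect d s0 (fun _ => ffact_deg R j k (n:=n)).
Proof.
have bm : 0 < beta * m0 by exact: mulr_gt0.
have pe := profile_err_ge0 R d a.
set y := (beta * m0) * (1 - (profile_err R d a + 1) * eta).
have y0 : 0 <= y by rewrite mulr_ge0 ?subr_ge0 // ltW.
have P1 : P <= 1.
  apply: (@le_trans _ _ eta); last by apply: (le_trans eta_le); lra.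
  by have := P_le (leq0n _); rewrite expr0 mul1r.
apply: (@le_trans _ _ (y ^+ k * (1 - P))).
  rewrite mulrA; apply: ler_wpM2r; first by rewrite subr_ge0.
  rewrite /y [leRHS]exprMn; apply: ler_wpM2l; first by rewrite exprn_ge0 // ltW.
  rewrite -mulrA; apply: bernoulli; rewrite err_small andbT mulr_ge0 ?addr_ge0 //.
  exact: ltW.
apply: expect_ge_regular => //.
- by rewrite exprn_ge0.
- move=> x G Gr rg; apply: ffact_ge_exp => //.
  have E := deficit_reachable d_ge2 Gr.
  have := regular_profile d_ge2 eta_gt0 eta_le eta_L rg (leq_subr j d.-1).
  rewrite subKn; last exact: ltnW.
  rewrite ler_norml E -/a -/c -/m0 => /andP[+ _].
  set D := (num_deg j G)%:R.
  have -> : m0 * c / L ^+ a = beta * m0 by rewrite /beta; ring.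
  have : profile_err R d a * eta * m0 / L ^+ a <= beta * m0 * (profile_err R d a * eta).
    have -> : beta * m0 * (profile_err R d a * eta)
       = c * (profile_err R d a * eta * m0 / L ^+ a) by rewrite /beta; ring.
    apply: ler_peMl => //; apply: divr_ge0; last by rewrite exprn_ge0 // ltW.
    by apply: mulr_ge0; rewrite ?(ltW m0_gt0) // mulr_ge0 // ltW.
  have := k_small; rewrite /y; set w := beta * m0; set q := profile_err R d a * eta.
  have -> : (profile_err R d a + 1) * eta = q + eta by rewrite /q; ring.
  lra.
Qed.

Lemma ffact_bound_lower :
  1 - bound_const * eta <= expect d s1 (fun _ => ffact_deg R j k (n:=n)) / (beta * m1) ^+ k.
Proof.
have bm : 0 < beta * m0 by exact: mulr_gt0.
have bk : 0 < beta ^+ k by rewrite exprn_gt0.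
have e0 := ltW eta_gt0.
have V0 : 0 <= V.
  by rewrite divr_ge0 ?mulr_ge0 ?(ltW bk) ?(ltW L_gt0).
have hM s : (s0 <= s <= s1)%N ->
    expect d s (fun _ => ffact_deg R j k (n:=n)) <= M * (deficit_after d n s)%:R ^+ k.
  move=> sin; apply: le_trans (upper_at sin) _.
  apply: ler_wpM2r; first by rewrite exprn_ge0.
  apply: ler_wpM2r; first exact: ltW.
  apply: ler_pM.
  - by rewrite addr_ge0 // mulr_ge0.
  - by rewrite addr_ge0 // mulr_ge0.
  - by have := eta_le; lra.
  by rewrite lerD2l; apply: ler_piMr => //; apply: (le_trans eta_le); lra.
have hV s : (s0 <= s <= s1)%N ->
    expect d s (fun _ G => ffact_deg R j k G * low R d G) <=
    k%:R * expect d s (fun _ => ffact_deg R j k (n:=n)) + V * (deficit_after d n s)%:R ^+ k.+1.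
  move=> /andP[l0 l1]; have bigs : (2 * d * d <= deficit_after d n s)%N := deficit_after_big_mono l1 big.
  apply: le_trans (expect_ffact_low_le d_ge2 k jd' r01 l0 bigs) _; rewrite lerD2l.
  set ms : R := (deficit_after d n s)%:R.
  have ms0 : 0 <= ms by [].
  have q0 : 0 <= (ms / m0) ^+ k.+1 by rewrite exprn_ge0 // divr_ge0 // ltW.
  apply: (le_trans (ler_wpM2l (mulr_ge0 q0 (expR_ge0 _)) P1_le)).
  have Z0 : 0 <= ms ^+ k.+1 * (beta ^+ k / L * K2).
    by rewrite mulr_ge0 ?exprn_ge0 // mulr_ge0 // divr_ge0 ?(ltW bk) ?(ltW L_gt0).
  have -> : (ms / m0) ^+ k.+1 * expR (growth d n r k.+1 s0 s) * ((beta * m0) ^+ k * (m0 / L) * K2)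
     = expR (growth d n r k.+1 s0 s) * (ms ^+ k.+1 * (beta ^+ k / L * K2)).
    have -> : ms ^+ k.+1 = (ms / m0) ^+ k.+1 * m0 ^+ k.+1.
      by rewrite -exprMn divfK // gt_eqF.
    by rewrite [(beta * m0) ^+ k]exprMn [m0 ^+ k.+1]exprSr; ring.
  have gr : expR (growth d n r k.+1 s0 s) <= 2 by apply/exp_le2/growth_le; rewrite ?l0.
  apply: (le_trans (ler_wpM2r Z0 gr)); rewrite /V le_eqVlt; apply/orP; left; apply/eqP.
  by ring.
have := expect_ffact_lower d_ge2 s01 big V0 hM hV.
rewrite -/m0 -/m1 => main.
rewrite exprMn invfM mulrCA.
rewrite [leRHS]mulrC ler_pdivlMr //; apply: le_trans main.
have low0 : beta ^+ k * ((1 - k%:R * (profile_err R d a + 1) * eta) * (1 - P))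
    <= expect d s0 (fun _ => ffact_deg R j k (n:=n)) / m0 ^+ k.
  by rewrite ler_pdivlMr ?exprn_gt0 // mulrAC -exprMn; exact: lower_at.
have dc := drift_const_ge0 R d k; have pe := profile_err_ge0 R d a.
have k0 : 0 <= k%:R :> R by [].
have Pe : P <= eta by have := P_le (leq0n _); rewrite expr0 mul1r.
have h1 : drift_const R d k * M / m1 <= beta ^+ k * (drift_const R d k * (2 * (1 + K1)) * eta).
  have -> : drift_const R d k * M / m1 = beta ^+ k * (drift_const R d k * (2 * (1 + K1)) * m1^-1).
    by rewrite /M; ring.
  apply: ler_wpM2l; first exact: ltW.
  by apply: ler_wpM2l => //; rewrite mulr_ge0 // mulr_ge0 // addr_ge0.
have h2 : 2 ^+ k * (k%:R * d%:R ^+ 2) * V * (min_clock R d n s1 - min_clock R d n s0)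
   <= beta ^+ k * (2 ^+ k * (k%:R * d%:R ^+ 2) * (2 * K2) * eta).
  have -> : 2 ^+ k * (k%:R * d%:R ^+ 2) * V * (min_clock R d n s1 - min_clock R d n s0)
   = beta ^+ k * (2 ^+ k * (k%:R * d%:R ^+ 2) * (2 * K2)
       * ((min_clock R d n s1 - min_clock R d n s0) / L)) by rewrite /V; ring.
  apply: ler_wpM2l; first exact: ltW.
  apply: ler_wpM2l; first by rewrite mulr_ge0 ?mulr_ge0 ?exprn_ge0.
  by rewrite ler_pdivrMr.
have h3 : 1 - k%:R * (profile_err R d a + 1) * eta - eta
  <= (1 - k%:R * (profile_err R d a + 1) * eta) * (1 - P).
  have kp : 0 <= k%:R * (profile_err R d a + 1) by rewrite mulr_ge0 ?addr_ge0.
  have := mulr_ge0 (mulr_ge0 kp e0) P_ge0.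
  lra.
have h4 := ler_wpM2l (ltW bk) h3.
have h5 : beta ^+ k * ((2 * (1 + K1) + 2 * K1 + 2) * eta) >= 0.
  apply: mulr_ge0; first exact: ltW.
  by apply: mulr_ge0 => //; have := K1_ge0; lra.
rewrite /bound_const; lra.
Qed.

End FiniteBound.

(** * Choosing the parameters *)

Local Open Scope classical_set_scope.
Local Open Scope ring_scope.

Lemma near_ln_ge (R : realType) (c : R) : \forall n \near \oo, c <= ln (n%:R : R).
Proof.
near=> n; have nc : expR c <= n%:R by near: n; exact: nbhs_infty_ger.
have n0 : 0 < n%:R :> R by apply: lt_le_trans nc; exact: expR_gt0.
by rewrite -(expRK c) ler_ln ?posrE ?expR_gt0.
Unshelve. all: by end_near. Qed.

(** Apply ln y <= y to the square root of [y]. *)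
Lemma ln_le_linear (R : realType) (c y : R) : 0 < c -> (2 / c) ^+ 2 <= y -> ln y <= c * y.
Proof.
move=> c0 cy; have y0 : 0 < y by apply: lt_le_trans cy; rewrite exprn_gt0 ?divr_gt0.
have s0 : 0 < Num.sqrt y by rewrite sqrtr_gt0.
have sy : Num.sqrt y ^+ 2 = y by rewrite sqr_sqrtr // ltW.
have cs : 2 / c <= Num.sqrt y.
  by rewrite -ler_sqr ?nnegrE ?sy // ?ltW // divr_gt0.
rewrite -sy lnXn // mulr2n.
have h := ltW (ln_sublinear s0).
have : 2 <= c * Num.sqrt y by rewrite mulrC -ler_pdivrMr.
move=> /(ler_wpM2r (ltW s0)); lra.
Qed.

Lemma near_lnln (R : realType) (b A c : R) : 0 <= A -> 0 < c ->
  \forall n \near \oo, b + A * ln (ln (n%:R : R)) <= c * ln (n%:R : R).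
Proof.
move=> A0 c0; have c1 : 0 < c / (2 * (A + 1)) by rewrite divr_gt0 // mulr_gt0 //; lra.
near=> n.
have h1 : 2 * `|b| / c <= ln (n%:R : R) by near: n; exact: near_ln_ge.
have h2 : (2 / (c / (2 * (A + 1)))) ^+ 2 <= ln (n%:R : R) by near: n; exact: near_ln_ge.
have h3 : 1 <= ln (n%:R : R) by near: n; exact: near_ln_ge.
have := ln_le_linear c1 h2; set L := ln n%:R in h1 h3 *.
rewrite ler_pdivrMr // in h1.
have := ler_norm b => bb lL.
have lL0 : 0 <= ln L by apply: ln_ge0.
have : A * ln L <= (A + 1) * (c / (2 * (A + 1)) * L).
  apply: (@le_trans _ _ ((A + 1) * ln L)); first by rewrite ler_wpM2r //; lra.
  by rewrite ler_wpM2l //; lra.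
have -> : (A + 1) * (c / (2 * (A + 1)) * L) = c * L / 2.
  by field; rewrite gt_eqF //; lra.
lra.
Unshelve. all: by end_near. Qed.

Lemma deficit_after_max_edges d n t : (t <= max_edges d n)%N ->
  (2 * t <= deficit_after d n (max_edges d n - t) <= 2 * t + 1)%N.
Proof.
rewrite /deficit_after /max_edges => tN; have := odd_double_half (d * n).
by case: (odd _); rewrite -muln2 => /= E; lia.
Qed.

Lemma leq_max_edges d n : (2 <= d)%N -> (n <= max_edges d n)%N.
Proof.
by move=> d2; rewrite -{1}[n]doubleK; apply: half_leq; rewrite -mul2n leq_mul2r d2 orbT.
Qed.

Section Asymptotic.
Variables (R : realType) (d n j k A : nat) (eta L : R).
Hypothesis d_ge2 : (2 <= d)%N.
Hypothesis A_big : (2 * d * k.+2 < A)%N.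
Hypothesis eta_gt0 : 0 < eta.
Hypothesis L_ge1 : 1 <= L.

Let L_gt0 : 0 < L. Proof. exact: lt_le_trans L_ge1. Qed.

(** The irregular states have probability at most this times L^(2d) / m. *)
Definition irregular_const : R := (3 * d%:R + 1) ^+ 2 *
  (excess_const R d + (\sum_(i < d.-1) imbalance_const R d i.+1) / eta ^+ 2).

Lemma irregular_const_ge0 : 0 <= irregular_const.
Proof.
have Sk0 : 0 <= \sum_(i < d.-1) imbalance_const R d i.+1.
  by apply: sumr_ge0 => i _; exact: imbalance_const_ge0.
apply: mulr_ge0; rewrite ?sqr_ge0 // addr_ge0 ?excess_const_ge0 //.
by rewrite divr_ge0 // sqr_ge0.
Qed.

Lemma irregular_bound_small s : L ^+ A <= (deficit_after d n s)%:R -> irregular_const / eta <= L ->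
  L ^+ (2 * d * k.+1) * irregular_bound d n s eta L ((3 * d%:R + 1) * L) <= eta.
Proof.
move=> m0A irrL.
have ec0 := excess_const_ge0 R d.
have Sk0 : 0 <= \sum_(i < d.-1) imbalance_const R d i.+1.
  by apply: sumr_ge0 => i _; exact: imbalance_const_ge0.
have ic0 := irregular_const_ge0.
have LA : 0 < L ^+ A by rewrite exprn_gt0.
have b1 : irregular_bound d n s eta L ((3 * d%:R + 1) * L)
    <= irregular_const * L ^+ (2 * d) / L ^+ A.
  rewrite /irregular_bound /irregular_const.
  set ec := excess_const R d in ec0 *; set Sk := \sum_(i < d.-1) _ in Sk0 *.
  set B := (3 * d%:R + 1) * L.
  apply: (@le_trans _ _ (B ^+ 2 / L ^+ A * ((ec + Sk / eta ^+ 2) * L ^+ (2 * d.-1)))).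
    apply: ler_pM.
    - by rewrite divr_ge0 ?sqr_ge0.
    - by rewrite addr_ge0 // mulr_ge0 // sqr_ge0.
    - apply: ler_wpM2l; first exact: sqr_ge0.
      by rewrite lef_pV2 ?posrE //; exact: lt_le_trans m0A.
    rewrite mulrDl; apply: lerD.
      by rewrite ler_peMr // exprn_ege1.
    rewrite expr_div_n -exprM [(d.-1 * 2)%N]mulnC le_eqVlt; apply/orP; left; apply/eqP.
    by ring.
  rewrite le_eqVlt; apply/orP; left; apply/eqP.
  have -> : (2 * d = 2 + 2 * d.-1)%N by rewrite -{1}(prednK (ltnW d_ge2)) mulnS.
  by rewrite exprD /B; ring.
apply: (@le_trans _ _ (L ^+ (2 * d * k.+1) * (irregular_const * L ^+ (2 * d) / L ^+ A))).
  by apply: ler_wpM2l => //; rewrite exprn_ge0 // ltW.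
have -> : L ^+ (2 * d * k.+1) * (irregular_const * L ^+ (2 * d) / L ^+ A)
   = irregular_const * (L ^+ (2 * d * k.+2) / L ^+ A).
  by rewrite [(2 * d * k.+2)%N]mulnS exprD; ring.
apply: (@le_trans _ _ (irregular_const * L^-1)).
  apply: ler_wpM2l => //; rewrite ler_pdivrMr // mulrC ler_pdivlMr //.
  by rewrite -exprSr; apply: ler_weXn2l.
by rewrite ler_pdivrMr // mulrC -ler_pdivrMr.
Qed.

(** Each of the two summands of [growth] takes half of the allowed [eta]. *)
Lemma growth_small K s0 s (q : R := 2 ^+ k.+1) Q t : (K <= k.+1)%N ->
  0 <= min_clock R d n s - min_clock R d n s0 <= Q -> Q <= eta ^+ 2 / (2 * q * k.+1%:R) * L ->
  0 < t -> 2 * t <= (deficit_after d n s)%:R -> q * second_order R d k.+1 / eta <= t ->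
  growth d n (eta * L)^-1 K s0 s <= eta.
Proof.
move=> Kk /andP[ls ls1] QL t0 ms tso; rewrite /growth.
have e0 := ltW eta_gt0.
have q0 : 0 < q by rewrite exprn_gt0.
have KkR : K%:R <= k.+1%:R :> R by rewrite ler_nat.
have rg : 0 < (eta * L)^-1 by rewrite invr_gt0 mulr_gt0.
have soK : second_order R d K <= second_order R d k.+1.
  rewrite /second_order; apply: ler_wpM2l; first by rewrite exprn_ge0.
  apply: lerD; first by apply: ler_wpM2l => //; rewrite mulr_ge0.
  by apply: ler_wpM2l => //; apply: ler_weXn2l => //; rewrite (ler_nat _ 1).
have g1 : K%:R * (eta * L)^-1 * (min_clock R d n s - min_clock R d n s0) <= eta / (2 * q).
  apply: (@le_trans _ _ (k.+1%:R * (eta * L)^-1 * (eta ^+ 2 / (2 * q * k.+1%:R) * L))).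
    apply: ler_pM => //; first by rewrite mulr_ge0 // ltW.
      by rewrite ler_wpM2r // ltW.
    exact: le_trans ls1 QL.
  rewrite le_eqVlt; apply/orP; left; apply/eqP.
  by field; rewrite nat1r pnatr_eq0 !gt_eqF.
have g2 : second_order R d K / (deficit_after d n s)%:R <= eta / (2 * q).
  rewrite ler_pdivrMr; last by apply: lt_le_trans ms; rewrite mulr_gt0.
  apply: (le_trans soK).
  apply: (@le_trans _ _ (eta / (2 * q) * (2 * t))).
    have -> : eta / (2 * q) * (2 * t) = t * eta / q by field; rewrite gt_eqF.
    by rewrite ler_pdivlMr // mulrC -ler_pdivrMr.
  by apply: ler_wpM2l => //; rewrite divr_ge0 // mulr_ge0 // ltW.
apply: (@le_trans _ _ (q * (eta / (2 * q) + eta / (2 * q)))).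
  apply: ler_pM.
  - by rewrite exprn_ge0.
  - apply: addr_ge0; last by rewrite divr_ge0 // second_order_ge0.
    by apply: mulr_ge0 => //; apply: mulr_ge0 => //; exact: ltW.
  - by rewrite /q; apply: ler_weXn2l => //; rewrite (ler_nat _ 1).
  exact: lerD.
by rewrite le_eqVlt; apply/orP; left; apply/eqP; field; rewrite gt_eqF.
Qed.

(** The slack is of the order of the square root of L, the allowance is eta L. *)
Lemma clock_slack_small s : eta * L <= L -> ln (d%:R : R) + 1 <= eta * L / 2 ->
  3 * (12 * d%:R ^+ 3 / eta) ^+ 2 <= L -> min_clock R d n s <= ln d%:R + L ->
  min_clock R d n s + clock_slack R d n s + 1 <= (1 + eta) * L.
Proof.
move=> etaL1 lndL sqL chi.
have l00 := min_clock_ge0 R d n s; rewrite /clock_slack.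
set l0 := min_clock R d n s in chi l00 *; set del := eta / (12 * d%:R ^+ 3).
have d0 : 0 < d%:R :> R by rewrite ltr0n ltnW.
have D0 : 0 < d%:R ^+ 3 :> R by rewrite exprn_gt0.
have del0 : 0 < del by rewrite divr_gt0 // mulr_gt0.
have sq1 : Num.sqrt (1 + l0) <= del * L.
  have dL : 0 <= del * L by apply: mulr_ge0; exact: ltW.
  rewrite -ler_sqr ?nnegrE ?sqrtr_ge0 //.
  rewrite sqr_sqrtr ?addr_ge0 //.
  apply: (@le_trans _ _ (3 * L)); first by have := L_ge1; lra.
  have -> : (del * L) ^+ 2 = L * (L / (12 * d%:R ^+ 3 / eta) ^+ 2).
    by rewrite /del; field; rewrite !gt_eqF.
  rewrite [3 * L]mulrC; apply: ler_wpM2l; first exact: ltW.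
  by rewrite ler_pdivlMr // exprn_gt0 // divr_gt0 // mulr_gt0.
have D60 : 0 <= 6 * d%:R ^+ 3 :> R by rewrite mulr_ge0 // ltW.
have := ler_wpM2l D60 sq1.
have -> : 6 * d%:R ^+ 3 * (del * L) = eta * L / 2.
  by rewrite /del; field; rewrite gt_eqF.
lra.
Qed.

Hypothesis jd : (j < d.-1)%N.
Hypothesis eta_le : eta <= 1 / 2.
Let a := (d.-1 - j)%N.
Hypothesis err_small : (profile_err R d a + 1) * eta <= 1.
Let q : R := 2 ^+ k.+1.

(** The hypotheses hold for all large n when [L] is the logarithm of n.  The first phase
ends when the integer part of L^A is the number of remaining edges; this is
admissible because L^A <= n. *)
Lemma moment_ratio_bound (t : nat)
   (D := expect d (max_edges d n - t) (fun _ => ffact_deg R j k (n:=n))) :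
  L = ln (n%:R : R) ->
  1 <= eta * L -> k%:R <= eta * L -> irregular_const / eta <= L ->
  ln (d%:R : R) + 1 <= eta * L / 2 -> 3 * (12 * d%:R ^+ 3 / eta) ^+ 2 <= L ->
  ln 5 + A%:R * ln L <= eta ^+ 2 / (2 * q * k.+1%:R) * L ->
  ln 5 + A%:R * ln L <= eta * L -> A%:R * ln L <= L ->
  (d * d <= t)%N -> eta^-1 <= t%:R -> q * second_order R d k.+1 / eta <= t%:R ->
  t%:R <= L ^+ A ->
  1 - bound_const R d j k * eta <=
     D / (((d - 1) ^_ a)%:R / L ^+ a * (deficit_after d n (max_edges d n - t))%:R) ^+ k
  <= 1 + bound_const R d j k * eta.
Proof.
move=> LE etaL kL irrL lndL sqL lnln1 lnln2 lnA tdd teta tso tA.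
have e0 := ltW eta_gt0.
have n0 : 0 < n%:R :> R.
  by rewrite ltNge; apply/negP => n0; have := L_ge1; rewrite LE ln0 // ler10.
have nL : n%:R = expR L :> R by rewrite LE lnK.
have LAn : L ^+ A <= n%:R.
  by rewrite nL -[L in L ^+ _]lnK ?posrE // -expRM_natl ler_expR.
(* The number of remaining edges at the end of the first phase. *)
pose t0 := Num.truncn (L ^+ A).
have LA0 : 0 <= L ^+ A by rewrite exprn_ge0 // ltW.
have tt0 : (t <= t0)%N by rewrite /t0 truncn_ge_nat.
have t0u : t0%:R <= L ^+ A by rewrite -truncn_ge_nat.
have t0l : L ^+ A < t0.+1%:R by rewrite -truncn_le_nat.
have t0N : (t0 <= max_edges d n)%N.
  by apply: leq_trans (leq_max_edges n d_ge2); rewrite -(ler_nat R); apply: le_trans LAn.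
have /andP[m1l m1u] := deficit_after_max_edges (leq_trans tt0 t0N).
have /andP[m0l m0u] := deficit_after_max_edges t0N.
set s1 := (max_edges d n - t)%N in D m1l m1u *.
set s0 := (max_edges d n - t0)%N in m0l m0u.
have s01 : (s0 <= s1)%N by rewrite leq_sub2l.
have big : (2 * d * d <= deficit_after d n s1)%N by apply: leq_trans m1l; rewrite -mulnA leq_mul2l.
have big0 : (2 * d * d <= deficit_after d n s0)%N := deficit_after_big_mono s01 big.
have Mono s : (s <= s1)%N -> (deficit_after d n s1 <= deficit_after d n s)%N.
  by move=> ss; rewrite /deficit_after leq_sub2l // leq_mul2l.
rewrite -(ler_nat R) natrM in m1l; rewrite -(ler_nat R) natrD natrM in m0u.
rewrite -(ler_nat R) natrM in m0l.
have m0A : L ^+ A <= (deficit_after d n s0)%:R.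
  have t01 : 1 <= t0%:R :> R.
    rewrite (ler_nat _ 1); apply: leq_trans tt0; apply: leq_trans tdd.
    by rewrite muln_gt0 (ltnW d_ge2).
  by apply: le_trans m0l; move: t0l; rewrite -natr1; lra.
have m05 : (deficit_after d n s0)%:R + 2 <= 5 * L ^+ A.
  have : 1 <= L ^+ A by rewrite exprn_ege1.
  lra.
have lnm0 : ln ((deficit_after d n s0)%:R + 2 : R) <= ln 5 + A%:R * ln L.
  rewrite mulr_natl -lnXn // -lnM ?posrE ?exprn_gt0 //.
  by rewrite ler_ln ?posrE ?mulr_gt0 ?exprn_gt0 // ltr_wpDl.
have m08 := deficit_after_ge8 R d_ge2 big0; have m18 := deficit_after_ge8 R d_ge2 big.
have lnm0' : ln ((deficit_after d n s0)%:R : R) <= ln 5 + A%:R * ln L.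
  by apply: le_trans lnm0; rewrite ler_ln ?posrE //; lra.
have d2 : 2 <= d%:R :> R by rewrite ler_nat.
have dn_gt0 : 0 < (d * n)%:R :> R by rewrite natrM mulr_gt0 //; lra.
have lndn : ln ((d * n)%:R : R) = ln d%:R + L by rewrite natrM lnM ?posrE //; lra.
have lnd0 : 0 <= ln d%:R :> R by apply: ln_ge0; lra.
have clo : (1 - eta) * L <= min_clock R d n s0.
  apply: le_trans (min_clock_ge_ln R d_ge2 big0).
  have : ln ((d * n)%:R : R) <= ln ((d * n)%:R + 2) by rewrite ler_ln ?posrE //; lra.
  rewrite lndn; lra.
have chi : min_clock R d n s0 <= ln d%:R + L.
  have := @min_clock_diff_le R d n d_ge2 0%N s0 (leq0n _) big0.
  rewrite min_clock0 subr0 /deficit_after muln0 subn0 -/(deficit_after d n s0) lndn.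
  have : 0 <= ln ((deficit_after d n s0)%:R : R) by apply: ln_ge0; lra.
  lra.

have etaL1 : eta * L <= L by apply: ler_piMl; [exact: ltW | apply: (le_trans eta_le); lra].
have chi2 := clock_slack_small etaL1 lndL sqL chi.
pose B : R := (3 * d%:R + 1) * L.
have hB : d%:R + 1 + d%:R * min_clock R d n s0 <= B.
  have l02 : min_clock R d n s0 <= 2 * L by lra.
  have dd0 : 0 <= d%:R :> R by [].
  have := ler_wpM2l dd0 l02; have := ler_wpM2l dd0 L_ge1; rewrite /B; lra.
have ld : min_clock R d n s1 - min_clock R d n s0 <= ln 5 + A%:R * ln L.
  apply: (le_trans (min_clock_diff_le R d_ge2 s01 big)).
  have : 0 <= ln ((deficit_after d n s1)%:R : R) by apply: ln_ge0; lra.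
  lra.
have cd : min_clock R d n s1 - min_clock R d n s0 <= eta * L by apply: le_trans ld lnln2.
have m1eta : ((deficit_after d n s1)%:R)^-1 <= eta :> R.
  rewrite invf_ple ?posrE //; [|lra].
  by apply: (le_trans teta); apply: le_trans m1l; rewrite ler_peMl //; lra.
have tp : 0 < t%:R :> R by apply: lt_le_trans teta; rewrite invr_gt0.
have growth_le K s : (K <= k.+1)%N -> (s0 <= s <= s1)%N ->
    growth d n (eta * L)^-1 K s0 s <= eta.
  move=> Kk /andP[ss0 ss1]; apply: growth_small Kk _ lnln1 tp _ tso.
    rewrite subr_ge0 min_clock_mono //=.
    by apply: le_trans ld; rewrite lerD2r min_clock_mono.
  by apply: (le_trans m1l); rewrite ler_nat Mono.
have [al1 al2 _] := pred_sub_bounds jd.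
have k_small : k%:R <= eta * (((d - 1) ^_ a)%:R / L ^+ a * (deficit_after d n s0)%:R).
  apply: (le_trans kL); apply: ler_wpM2l => //.
  apply: (@le_trans _ _ (1 / L ^+ a * L ^+ A)).
    rewrite mul1r mulrC -expfB; last first.
      by apply: leq_ltn_trans al2 _; apply: leq_ltn_trans A_big; rewrite mulnAC leq_pmull.
    rewrite -[leLHS]expr1; apply: ler_weXn2l => //; rewrite subn_gt0.
    by apply: leq_ltn_trans al2 _; apply: leq_ltn_trans A_big; rewrite mulnAC leq_pmull.
  apply: ler_pM => //; rewrite ?exprn_ge0 ?divr_ge0 ?exprn_ge0 ?(ltW L_gt0) //.
  apply: ler_wpM2r; first by rewrite invr_ge0 exprn_ge0 // ltW.
  by rewrite (ler_nat _ 1) ffact_gt0.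
have P_small := irregular_bound_small m0A irrL.
apply/andP; split.
- by apply: (@ffact_bound_lower R d n d_ge2 j k s0 s1 eta L B).
- by apply: (@ffact_bound_upper R d n d_ge2 j k s0 s1 eta L B).
Qed.

End Asymptotic.

(** * The limit *)

(** The deficit is 2t or 2t + 1, according to the parity of dn; replacing it by 2t
costs a factor (1 + eta)^[k] at most. *)
Lemma ratio_close (R : realType) (K C eta D beta m t : R) (k : nat) :
  0 <= K -> 0 <= eta <= 1 -> 0 < beta -> 0 < t -> 2 * t <= m <= 2 * t + 1 -> t^-1 <= eta ->
  0 <= D -> 1 - K * eta <= D / (beta * m) ^+ k <= 1 + K * eta ->
  `|1 - D / (beta * (2 * t)) ^+ k| <= (K + 2 ^+ k + K * 2 ^+ k) * eta.
Proof.
move=> K0 /andP[e0 e1] b0 t0 /andP[m1 m2] te D0 /andP[l u].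
have m0 : 0 < m by lra.
have tt : 0 < 2 * t by lra.
set q := (m / (2 * t)) ^+ k.
have -> : D / (beta * (2 * t)) ^+ k = D / (beta * m) ^+ k * q.
  rewrite /q -!exprVn -mulrA -exprMn; congr (_ * _ ^+ _).
  by field; rewrite !gt_eqF.
have q1 : 1 <= q by rewrite exprn_ege1 // ler_pdivlMr // mul1r.
have q2 : q <= 1 + 2 ^+ k * eta.
  have h : m / (2 * t) <= 1 + 1 * eta.
    rewrite ler_pdivrMr // mul1r.
    have : 1 <= eta * t by rewrite mulrC -ler_pdivrMl // mulr1.
    lra.
  apply: (@le_trans _ _ ((1 + 1 * eta) ^+ k)).
    by apply: lerXn2r; rewrite ?nnegrE ?divr_ge0 // ?ltW //; lra.
  have := @exprn_1D_le R 1 eta k ler01 (introT andP (conj e0 e1)).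
  by have -> : 1 + 1 = 2 :> R by lra.
set x := D / _ in l u *.
have x0 : 0 <= x by rewrite divr_ge0 // exprn_ge0 // ltW // mulr_gt0.
have p0 : 0 <= 2 ^+ k :> R by rewrite exprn_ge0.
have xq1 : x <= x * q by rewrite ler_peMr.
have Ke : 0 <= K * eta by exact: mulr_ge0.
have pe : 0 <= 2 ^+ k * eta by exact: mulr_ge0.
have xq2 : x * q <= (1 + K * eta) * (1 + 2 ^+ k * eta) by apply: ler_pM => //; lra.
have Kpe : K * 2 ^+ k * eta * eta <= K * 2 ^+ k * eta.
  by rewrite ler_piMr // mulr_ge0 // mulr_ge0.
have Kpe0 : 0 <= K * 2 ^+ k * eta by rewrite mulr_ge0 // mulr_ge0.
by rewrite ler_norml; apply/andP; split; lra.
Qed.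

Theorem theorem1p5 (R : realType) (d : nat) (hd : (2 <= d)%N)
  (j : nat) (hj : (j <= d - 2)%N) (k : nat) (hk : (1 <= k)%N)
  (gamma : R) (hgamma : 0 < gamma) (t : nat -> nat)
  (ht : \forall n \near \oo, (t n)%:R < ln (n%:R : R) `^ gamma)
  (htoo : t n @[n --> \oo] --> \oo) :
  dprocess_E d (max_edges d n - t n)%N
      (fun G : graph n => (num_deg j G ^_ k)%:R)
    / f_asym R j d (t n) n ^+ k @[n --> \oo] --> (1 : R).
Proof.
have jd : (j < d.-1)%N by move: hj hd; lia.
pose a := (d.-1 - j)%N.
pose A := maxn (2 * d * k.+2).+1 (Num.truncn gamma).+1.
have A_big : (2 * d * k.+2 < A)%N by rewrite /A leq_max leqnn.
have gA : gamma <= A%:R.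
  apply: ltW; rewrite -truncn_lt_nat ?(ltW hgamma) //.
  by rewrite /A leq_max leqnn orbT.
have near_t (c : R) : \forall n \near \oo, c <= (t n)%:R.
  have tn : \forall m \near \oo, c <= m%:R by exact: nbhs_infty_ger.
  exact: (htoo _ tn).
pose K := bound_const R d j k.
have K0 : 0 <= K.
  rewrite /K /bound_const; have dc := drift_const_ge0 R d k; have pe := profile_err_ge0 R d a.
  have pb : 0 <= profile_bound R d.
    by apply: sumr_ge0 => i _; rewrite addr_ge0 ?profile_err_ge0.
  have C0 : 0 <= (d%:R + 1) * profile_bound R d by rewrite mulr_ge0 ?addr_ge0.
  by rewrite !(addr_ge0, mulr_ge0, exprn_ge0).
pose K' := K + 2 ^+ k + K * 2 ^+ k.
have p2 : 0 <= 2 ^+ k :> R by rewrite exprn_ge0.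
have K'0 : 0 <= K' := addr_ge0 (addr_ge0 K0 p2) (mulr_ge0 K0 p2).
have pe := profile_err_ge0 R d a.
apply/cvgrPdist_le => e e0.
(* Small enough for the moment bound, and so that the final error is at most e. *)
pose eta := Num.min (1 / 2) (Num.min (profile_err R d a + 1)^-1 (e / (K' + 1))).
have eta_gt0 : 0 < eta.
  by rewrite /eta !lt_min divr_gt0 //= invr_gt0 divr_gt0 ?andbT //; lra.
have eta_le : eta <= 1 / 2 by rewrite /eta ge_min lexx.
have err_small : (profile_err R d a + 1) * eta <= 1.
  by rewrite mulrC -ler_pdivlMr ?div1r; [rewrite /eta !ge_min lexx !orbT | lra].
have eta_e : K' * eta <= e.
  apply: (@le_trans _ _ ((K' + 1) * eta)); first by rewrite ler_wpM2r ?(ltW eta_gt0) //; lra.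
  by rewrite mulrC -ler_pdivlMr; [rewrite /eta !ge_min lexx !orbT | lra].
have c1 : 0 < eta ^+ 2 / (2 * 2 ^+ k.+1 * k.+1%:R).
  by rewrite divr_gt0 ?exprn_gt0 // !mulr_gt0 ?exprn_gt0.
near=> n.
set L := ln (n%:R : R).
have L1 : 1 <= L by rewrite /L; near: n; exact: near_ln_ge.
have L0 : 0 < L by lra.
have etaL : 1 <= eta * L.
  by rewrite mulrC -ler_pdivrMr // div1r; rewrite /L; near: n; exact: near_ln_ge.
have kL : k%:R <= eta * L by rewrite mulrC -ler_pdivrMr //; rewrite /L; near: n; exact: near_ln_ge.
have irrL : irregular_const d eta / eta <= L by rewrite /L; near: n; exact: near_ln_ge.
have lndL : ln (d%:R : R) + 1 <= eta * L / 2.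
  rewrite ler_pdivlMr // mulrC [eta * L]mulrC -ler_pdivrMr //; rewrite /L; near: n; exact: near_ln_ge.
have sqL : 3 * (12 * d%:R ^+ 3 / eta) ^+ 2 <= L by rewrite /L; near: n; exact: near_ln_ge.
have A0 : 0 <= A%:R :> R by [].
have ll1 : ln 5 + A%:R * ln L <= eta ^+ 2 / (2 * 2 ^+ k.+1 * k.+1%:R) * L.
  by rewrite /L; near: n; exact: near_lnln.
have ll2 : ln 5 + A%:R * ln L <= eta * L by rewrite /L; near: n; exact: near_lnln.
have ll3 : A%:R * ln L <= L.
  have : 0 + A%:R * ln L <= 1 * L by rewrite /L; near: n; exact: near_lnln.
  by rewrite add0r mul1r.
have tdd : (d * d <= t n)%N by rewrite -(ler_nat R); near: n; exact: near_t.
have teta : eta^-1 <= (t n)%:R by near: n; exact: near_t.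
have tso : 2 ^+ k.+1 * second_order R d k.+1 / eta <= (t n)%:R by near: n; exact: near_t.
have tA : (t n)%:R <= L ^+ A.
  have tg : (t n)%:R < L `^ gamma by rewrite /L; near: n.
  by apply: (le_trans (ltW tg)); rewrite -powR_mulrn ?ler_powR // ltW.
have main := moment_ratio_bound hd A_big eta_gt0 L1 jd eta_le err_small
  erefl etaL kL irrL lndL sqL ll1 ll2 ll3 tdd teta tso tA.
have tp : 0 < (t n)%:R :> R by apply: lt_le_trans teta; rewrite invr_gt0.
have tN : (t n <= max_edges d n)%N.
  apply: leq_trans (leq_max_edges n hd); rewrite -(ler_nat R); apply: (le_trans tA).
  have n0 : 0 < n%:R :> R.
    by rewrite ltNge; apply/negP => n0; move: L1; rewrite /L ln0 // ler10.
  by rewrite -[leRHS]lnK ?posrE // -[L in L ^+ _]lnK ?posrE // -expRM_natl ler_expR.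
have /andP[ml mu] := deficit_after_max_edges tN.
rewrite expect_dprocess_E /f_asym.
have -> : 2 * ((d - 1) ^_ (d - 1 - j))%:R * (t n)%:R / ln n%:R ^+ (d - 1 - j)
   = ((d - 1) ^_ a)%:R / L ^+ a * (2 * (t n)%:R) by rewrite /a /L !subn1; ring.
apply: le_trans eta_e; apply: ratio_close main => //.
- by rewrite ltW //=; lra.
- rewrite divr_gt0 ?exprn_gt0 // ltr0n ffact_gt0.
  by have [] := pred_sub_bounds jd.
- by move: ml mu; rewrite -!(ler_nat R) natrD !natrM => -> ->.
- by rewrite invf_ple ?posrE.
have big : (2 * d * d <= deficit_after d n (max_edges d n - t n))%N.
  by apply: leq_trans ml; rewrite -mulnA leq_mul2l.
rewrite -(expect_cst d n (max_edges d n - t n) 0).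
by apply: (expect_le hd big) => x G _; exact: ler0n.
Unshelve. all: by end_near. Qed.
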